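(* Each of the logics $\mathsf{TWJ}^+$, $\mathsf{C}^+$, $\mathsf{T}^+$, $\mathsf{E}^+$, $\mathsf{R}^+$ and $\mathsf{SetFr}$ is undecidable.
   Context: $\mathcal{L}$: formulas built from a countably infinite set $\mathsf{Prop}$ of letters by $\land,\lor,\to$ ($\land,\lor$ bind tighter than $\to$). $\mathsf{TWJ}^+$ is axiomatized by the schemes (1) $\varphi\to\varphi$; (2) $\varphi\land\psi\to\varphi$; (3) $\varphi\land\psi\to\psi$; (4) $(\varphi\to\psi)\land(\varphi\to\chi)\to(\varphi\to\psi\land\chi)$; (5) $\varphi\to\varphi\lor\psi$; (6) $\psi\to\varphi\lor\psi$; (7) $(\varphi\to\chi)\land(\psi\to\chi)\to(\varphi\lor\psi\to\chi)$; (8) $\varphi\land(\psi\lor\chi)\to(\varphi\land\psi)\lor(\varphi\land\chi)$; (9) $(\varphi\to\psi)\land(\psi\to\chi)\to(\varphi\to\chi)$; (10) $(\varphi\to\psi)\to[(\chi\to\varphi)\to(\chi\to\psi)]$; (11) $(\varphi\to\psi)\to[(\psi\to\chi)\to(\varphi\to\chi)]$, with rules modus ponens and adjunction (from $\varphi,\psi$ infer $\varphi\land\psi$). Then $\mathsf{C}^+$ adds $\varphi\land(\varphi\to\psi)\to\psi$; $\mathsf{T}^+$ further adds $(\varphi\to(\varphi\to\psi))\to(\varphi\to\psi)$; $\mathsf{E}^+$ further adds $((\varphi\to\varphi)\to\psi)\to\psi$ and $[((\varphi\to\varphi)\to\varphi)\land((\psi\to\psi)\to\psi)]\to[(\varphi\land\psi\to\varphi\land\psi)\to\varphi\land\psi]$;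 $\mathsf{R}^+$ further adds $\varphi\to((\varphi\to\psi)\to\psi)$ (each closed under modus ponens and adjunction). A frame is $(K,\cdot,N)$ with $\cdot:K\times K\to\mathcal{P}(K)$, $N\subseteq K$, writing $x\le y$ iff $y\in n\cdot x$ for some $n\in N$, such that $\le$ is reflexive and transitive, $N$ is a $\le$-upset, and whenever $z\in x\cdot y$, $x'\le x$, $y'\le y$, $z\le z'$ then $z'\in x'\cdot y'$ (operations lifted to sets by unions). A valuation maps letters to $\le$-upsets; $x\Vdash\varphi\to\psi$ iff for all $y,z$ with $y\Vdash\varphi$ and $z\in x\cdot y$, $z\Vdash\psi$ ($\land,\lor$ pointwise); $\varphi$ is valid on a frame if satisfied at every $n\in N$ under every valuation. An $\mathsf{R}^+$-frame is a frame satisfying $x\cdot y\subseteq x\cdot(x\cdot y)$, $(x\cdot y)\cdot z\subseteq x\cdot(y\cdot z)$, $(x\cdot y)\cdot z\subseteq y\cdot(x\cdot z)$, $x\in x\cdot x$, $x\cdot y\subseteq(x\cdot y)\cdot y$, $x\in x\cdot N$, $x\cdot y\subseteq y\cdot x$; a set frame is an $\mathsf{R}^+$-frame additionally satisfying $x\cdot x\subseteq N\cdot x$. $\mathsf{SetFr}$ is the set of formulas valid on all set frames. *)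

(* Defs.v *)
From mathcomp Require Import all_boot.
From mathcomp Require Import boolp classical_sets.

Set Implicit Arguments.
Unset Strict Implicit.
Unset Printing Implicit Defensive.

(* The countably infinite set of propositional letters is [nat]. *)
Inductive form : Type :=
| Var of nat
| And of form & form
| Or of form & form
| Imp of form & form.

Declare Scope form_scope.
Delimit Scope form_scope with form.
Bind Scope form_scope with form.
Notation "A ⩓ B" := (And A B) (at level 40, left associativity) : form_scope.
Notation "A ⩔ B" := (Or A B) (at level 40, left associativity) : form_scope.
Notation "A ⟶ B" := (Imp A B) (at level 60, right associativity) : form_scope.

Section Hilbert.
Local Open Scope form_scope.

Inductive TWJ_axiom : form -> Prop :=
| ax_id A : TWJ_axiom (A ⟶ A)
| ax_andl A B : TWJ_axiom (A ⩓ B ⟶ A)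
| ax_andr A B : TWJ_axiom (A ⩓ B ⟶ B)
| ax_andI A B C : TWJ_axiom ((A ⟶ B) ⩓ (A ⟶ C) ⟶ (A ⟶ B ⩓ C))
| ax_orl A B : TWJ_axiom (A ⟶ A ⩔ B)
| ax_orr A B : TWJ_axiom (B ⟶ A ⩔ B)
| ax_orE A B C : TWJ_axiom ((A ⟶ C) ⩓ (B ⟶ C) ⟶ (A ⩔ B ⟶ C))
| ax_distr A B C : TWJ_axiom (A ⩓ (B ⩔ C) ⟶ (A ⩓ B) ⩔ (A ⩓ C))
| ax_conj_syll A B C : TWJ_axiom ((A ⟶ B) ⩓ (B ⟶ C) ⟶ (A ⟶ C))
| ax_prefix A B C : TWJ_axiom ((A ⟶ B) ⟶ ((C ⟶ A) ⟶ (C ⟶ B)))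
| ax_suffix A B C : TWJ_axiom ((A ⟶ B) ⟶ ((B ⟶ C) ⟶ (A ⟶ C))).

Inductive C_axiom : form -> Prop :=
| C_TWJ A : TWJ_axiom A -> C_axiom A
| ax_conj_mp A B : C_axiom (A ⩓ (A ⟶ B) ⟶ B).

Inductive T_axiom : form -> Prop :=
| T_C A : C_axiom A -> T_axiom A
| ax_contr A B : T_axiom ((A ⟶ (A ⟶ B)) ⟶ (A ⟶ B)).

Inductive E_axiom : form -> Prop :=
| E_T A : T_axiom A -> E_axiom A
| ax_E1 A B : E_axiom (((A ⟶ A) ⟶ B) ⟶ B)
| ax_E2 A B :
    E_axiom ((((A ⟶ A) ⟶ A) ⩓ ((B ⟶ B) ⟶ B)) ⟶
             ((A ⩓ B ⟶ A ⩓ B) ⟶ A ⩓ B)).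

Inductive R_axiom : form -> Prop :=
| R_E A : E_axiom A -> R_axiom A
| ax_assertion A B : R_axiom (A ⟶ ((A ⟶ B) ⟶ B)).

Inductive thm (Ax : form -> Prop) : form -> Prop :=
| thm_ax A : Ax A -> thm Ax A
| thm_mp A B : thm Ax (A ⟶ B) -> thm Ax A -> thm Ax B
| thm_adj A B : thm Ax A -> thm Ax B -> thm Ax (A ⩓ B).

End Hilbert.

Definition TWJplus : set form := thm TWJ_axiom.
Definition Cplus : set form := thm C_axiom.
Definition Tplus : set form := thm T_axiom.
Definition Eplus : set form := thm E_axiom.
Definition Rplus : set form := thm R_axiom.

Definition setdot (K : Type) (dot : K -> K -> set K) (X Y : set K) : set K :=
  (\bigcup_(x in X) \bigcup_(y in Y) dot x y)%classic.

Definition frame_le (K : Type) (dot : K -> K -> set K) (N : set K) (x y : K) :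
    Prop :=
  exists2 n, N n & dot n x y.

Definition upset (K : Type) (dot : K -> K -> set K) (N X : set K) : Prop :=
  forall x y, frame_le dot N x y -> X x -> X y.

Record frame : Type := Frame {
  carrier :> Type;
  (* [dot x y z] reads z \in x · y *)
  dot : carrier -> carrier -> set carrier;
  normal : set carrier;
  frame_le_refl : forall x, frame_le dot normal x x;
  frame_le_trans : forall x y z,
    frame_le dot normal x y -> frame_le dot normal y z -> frame_le dot normal x z;
  normal_upset : upset dot normal normal;
  dot_mono : forall x x' y y' z z', dot x y z ->
    frame_le dot normal x' x -> frame_le dot normal y' y -> frame_le dot normal z z' ->
    dot x' y' z'
}.

Record Rframe (F : frame) : Prop := {
  Rframe_conj_syll : forall x y : F,
    (dot x y `<=` setdot (@dot F) [set x] (dot x y))%classic;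
  Rframe_B : forall x y z : F,
    (setdot (@dot F) (dot x y) [set z] `<=`
     setdot (@dot F) [set x] (dot y z))%classic;
  Rframe_B' : forall x y z : F,
    (setdot (@dot F) (dot x y) [set z] `<=`
     setdot (@dot F) [set y] (dot x z))%classic;
  Rframe_conj_mp : forall x : F, dot x x x;
  Rframe_W : forall x y : F,
    (dot x y `<=` setdot (@dot F) (dot x y) [set y])%classic;
  Rframe_unit : forall x : F, setdot (@dot F) [set x]%classic (@normal F) x;
  Rframe_comm : forall x y : F, (dot x y `<=` dot y x)%classic
}.

Record set_frame (F : frame) : Prop := {
  set_frame_R : Rframe F;
  set_frame_idem : forall x : F,
    (dot x x `<=` setdot (@dot F) (@normal F) [set x])%classic
}.

Definition valuation (F : frame) (V : nat -> set F) : Prop :=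
  forall p, upset (@dot F) (@normal F) (V p).

Fixpoint sat (F : frame) (V : nat -> set F) (x : F) (A : form) : Prop :=
  match A with
  | Var p => V p x
  | And A B => sat V x A /\ sat V x B
  | Or A B => sat V x A \/ sat V x B
  | Imp A B => forall y z : F, sat V y A -> dot x y z -> sat V z B
  end.

Definition valid (F : frame) (A : form) : Prop :=
  forall V : nat -> set F, valuation V -> forall n : F, normal n -> sat V n A.

Definition SetFr : set form := fun A => forall F : frame, set_frame F -> valid F A.

Inductive recf : nat -> Type :=
| RZero n : recf n
| RSucc : recf 1
| RProj n (i : 'I_n) : recf n
| RComp k n (f : recf k) (g : 'I_k -> recf n) : recf n
| RPrec n (f : recf n) (g : recf n.+2) : recf n.+1
| RMu n (f : recf n.+1) : recf n.

(* Graph of the function h with h(0, v) = f(v), h(m+1, v) = g(m, h(m, v), v). *)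
Fixpoint prec_graph n (f : n.-tuple nat -> nat -> Prop)
    (g : n.+2.-tuple nat -> nat -> Prop) (m : nat) (v : n.-tuple nat) (y : nat) :
    Prop :=
  if m is m'.+1 then
    exists2 z, prec_graph f g m' v z & g [tuple of m' :: z :: v] y
  else f v y.

(* [reval f v y]: f is defined at v with value y. *)
Fixpoint reval n (f : recf n) : n.-tuple nat -> nat -> Prop :=
  match f in recf n return n.-tuple nat -> nat -> Prop with
  | RZero _ => fun _ y => y = 0
  | RSucc => fun v y => y = (thead v).+1
  | RProj _ i => fun v y => y = tnth v i
  | RComp k _ f g => fun v y =>
      exists2 w : k.-tuple nat, (forall i, reval (g i) v (tnth w i)) & reval f w y
  | RPrec _ f g => fun v y =>
      prec_graph (reval f) (reval g) (thead v) [tuple of behead v] y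
  | RMu _ f => fun v y =>
      reval f [tuple of y :: v] 0 /\
      forall z, z < y -> exists u, reval f [tuple of z :: v] u.+1
  end.

(* Cantor's pairing function. *)
Definition cantor_pair (x y : nat) : nat := 'C((x + y).+1, 2) + y.

(* A Gödel numbering; it is a bijection between formulas and [nat]. *)
Fixpoint code (A : form) : nat :=
  match A with
  | Var p => 4 * p
  | And A B => 4 * cantor_pair (code A) (code B) + 1
  | Or A B => 4 * cantor_pair (code A) (code B) + 2
  | Imp A B => 4 * cantor_pair (code A) (code B) + 3
  end.

Definition decidable_logic (L : set form) : Prop :=
  exists f : recf 1, forall A : form,
    exists2 b : bool, reval f [tuple code A] b & (b <-> L A).

Definition undecidable_logic (L : set form) : Prop := ~ decidable_logic L.

(* Main.v *)
Require Import Defs.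
From HB Require Import structures.
From mathcomp Require Import all_boot.
From mathcomp Require Import boolp classical_sets.

(* For each program [p] there is a formula [P] such that, for all [n], the formula
   [P ⟶ (start ⟶ goal)] with the numeral [n] inside [start] is a theorem of TWJ+ if
   [p] halts on [n], and is refuted in a set frame otherwise. A decision procedure
   for a logic between TWJ+ and SetFr then yields a program that contradicts itself
   when it is run on the code of its own [P].

   [P] is a conjunction of implications, which axioms (9)-(11) allow us to use as
   inequalities in a distributive lattice with an implication. The refuting frame
   consists of the pairs of sets of numbers, with union as product. The pairs of
   initial segments form a grid, and a run of [p] is drawn on it, with the contents
   of the registers written in unary on the successive rows. The inequality
   [(Y ⟶ J) ≤ J], where [Y] stands for the singletons and [J] for the sets that are
   not initial segments, forces the grid to grow. Since union is idempotent, adding a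
   singleton to a segment may also leave it unchanged, or produce junk; the first is
   detected by the parity of the segment, and the second by a letter for the
   complement of the grid.

   Conversely, a prime filter that refutes the formula generates such a grid of prime
   filters, row by row: the next row is built at its right end by the inequality for
   [J], and is pulled back along the previous row by axioms (10) and (11). If [p]
   halts, the grid reaches the forbidden halting state. *)

Set Implicit Arguments.
Unset Strict Implicit.
Unset Printing Implicit Defensive.

Local Open Scope form_scope.

(** * Soundness on set frames *)

Lemma thm_mono (Ax Bx : form -> Prop) (A : form) :
  (forall B, Ax B -> Bx B) -> thm Ax A -> thm Bx A.
Proof.
move=> AB; elim=> [B /AB|B C _ hBC _ hB|B C _ hB _ hC]; first exact: thm_ax.
- exact: thm_mp hBC hB.
- exact: thm_adj.
Qed.

Section Soundness.
Variables (F : frame) (HF : set_frame F) (V : nat -> set F) (HV : valuation V).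

Let HR : Rframe F := set_frame_R HF.

Lemma sat_upset A : upset (@dot F) (@normal F) (sat V ^~ A).
Proof.
elim: A => [p|A IA B IB|A IA B IB|A _ B _] x y xy /=.
- exact: HV xy.
- by case=> /(IA _ _ xy) hA /(IB _ _ xy).
- by case=> [/(IA _ _ xy)|/(IB _ _ xy)]; [left|right].
- move=> hx u v hu huv; apply: hx hu _.
  by apply: (dot_mono huv xy); apply: frame_le_refl.
Qed.

Lemma sat_normal_imp A B (n : F) :
  normal n -> (forall x, sat V x A -> sat V x B) -> sat V n (A ⟶ B).
Proof.
by move=> nn AB y z hy yz; apply: (sat_upset (x := y)); [exists n|apply: AB].
Qed.

Lemma sat_mp x A B : sat V x (A ⟶ B) -> sat V x A -> sat V x B.
Proof. by move=> xAB xA; apply: xAB xA _; apply: Rframe_conj_mp. Qed.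

Lemma R_axiom_sound A (n : F) : R_axiom A -> normal n -> sat V n A.
Proof.
have assoc (x y z u v : F) : dot x y u -> dot u z v ->
    exists2 w, dot y z w & dot x w v.
  move=> xyu uzv.
  have : setdot (@dot F) (dot x y) [set z]%classic v by exists u => //; exists z.
  by move/(Rframe_B HR) => -[_ -> [w yzw xwv]]; exists w.
have assoc' (x y z u v : F) : dot x y u -> dot u z v ->
    exists2 w, dot x z w & dot y w v.
  move=> xyu uzv.
  have : setdot (@dot F) (dot x y) [set z]%classic v by exists u => //; exists z.
  by move/(Rframe_B' HR) => -[_ -> [w yzw xwv]]; exists w.
move=> hA nn.
case: A / hA => [A hA|A B]; last first.
  apply: sat_normal_imp => // x xA y z yAB xyz.
  by apply: yAB xA _; apply: (Rframe_comm HR).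
(* A normal right unit [m] of [x] satisfies every [B ⟶ B]; the axioms of E apply their antecedents
   to it. *)
have unit (x : F) : exists2 m, normal m & dot x m x.
  by have [_ -> [m nm xmx]] := Rframe_unit HR x; exists m.
have self (x : F) B : sat V x ((B ⟶ B) ⟶ B) -> sat V x B.
  have [m nm xm] := unit x => /(_ m x _ xm); apply.
  by apply: sat_normal_imp.
case: A / hA => [A hA|A B|A B]; last 2 first.
- apply: sat_normal_imp => // x; have [m nm xm] := unit x => /(_ m x _ xm); apply.
  by apply: sat_normal_imp.
- apply: sat_normal_imp => // x [/self xA /self xB] y z yAB xyz.
  by apply: (yAB x z) => //; apply: (Rframe_comm HR).
case: A / hA => [A hA|A B]; last first.
  apply: sat_normal_imp => // x xAAB y z yA xyz.
  have [u xyu [_ -> uyz]] := Rframe_W HR xyz.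
  exact: (xAAB _ _ yA xyu) yA uyz.
case: A / hA => [A hA|A B]; last by apply: sat_normal_imp => // x [] xA /sat_mp; apply.
case: A / hA => [A|A B|A B|A B C|A B|A B|A B C|A B C|A B C|A B C|A B C];
  apply: sat_normal_imp => // x.
- by case.
- by case.
- by move=> [xAB xAC] y z yA xyz; split; [apply: xAB xyz|apply: xAC xyz].
- by left.
- by right.
- by move=> [xAC xBC] y z [yA|yB] xyz; [apply: xAC xyz|apply: xBC xyz].
- by move=> [xA [xB|xC]]; [left|right].
- move=> [xAB xBC] y z yA xyz.
  have [_ -> [u xyu xuz]] := Rframe_conj_syll HR xyz.
  by apply: xBC xuz; apply: xAB xyu.
- move=> xAB y z yCA xyz u v uC zuv.
  by have [w yuw xwv] := assoc _ _ _ _ _ xyz zuv; apply: xAB xwv; apply: yCA yuw.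
- move=> xAB y z yBC xyz u v uA zuv.
  by have [w xuw ywv] := assoc' _ _ _ _ _ xyz zuv; apply: yBC ywv; apply: xAB xuw.
Qed.

Lemma Rplus_sound A (n : F) : Rplus A -> normal n -> sat V n A.
Proof.
move=> hA; elim: hA n => [B hB n|B C _ hBC _ hB n nn|B C _ hB _ hC n nn] /=.
- exact: R_axiom_sound.
- exact: sat_mp (hBC _ nn) (hB _ nn).
- by split; [apply: hB|apply: hC].
Qed.

End Soundness.

Lemma Rplus_SetFr A : Rplus A -> SetFr A.
Proof. by move=> hA F HF V HV n; apply: Rplus_sound. Qed.

(** * The frame of pairs of sets of numbers under union *)

Section PowersetFrame.
Local Open Scope classical_set_scope.

Definition pt : Type := (set nat * set nat)%type.

Definition join (p q : pt) : pt := (p.1 `|` q.1, p.2 `|` q.2).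

Definition join_dot (p q : pt) : set pt := [set join p q].

Definition pt0 : pt := (set0, set0).

Lemma join0p p : join pt0 p = p.
Proof. by case: p => a b; rewrite /join !set0U. Qed.

Lemma joinC p q : join p q = join q p.
Proof. by rewrite /join setUC (setUC p.2). Qed.

Lemma joinA p q r : join p (join q r) = join (join p q) r.
Proof. by rewrite /join !setUA. Qed.

Lemma joinpp p : join p p = p.
Proof. by case: p => a b; rewrite /join !setUid. Qed.

(** The empty pair is the only normal point and a unit, so the frame order is equality and every set
    of points is an upset. *)
Lemma pt_le p q : frame_le join_dot [set pt0] p q <-> p = q.
Proof.
split=> [[_ -> ->]|->]; first by rewrite join0p.
by exists pt0; rewrite // /join_dot /= join0p.
Qed.

Lemma pt_le_refl p : frame_le join_dot [set pt0] p p.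
Proof. exact/pt_le. Qed.

Lemma pt_le_trans p q r : frame_le join_dot [set pt0] p q ->
  frame_le join_dot [set pt0] q r -> frame_le join_dot [set pt0] p r.
Proof. by move=> /pt_le -> . Qed.

Lemma pt_upset (X : set pt) : upset join_dot [set pt0] X.
Proof. by move=> p q /pt_le ->. Qed.

Lemma pt_dot_mono p p' q q' r r' : join_dot p q r ->
  frame_le join_dot [set pt0] p' p -> frame_le join_dot [set pt0] q' q ->
  frame_le join_dot [set pt0] r r' -> join_dot p' q' r'.
Proof. by move=> pqr /pt_le -> /pt_le -> /pt_le <-. Qed.

Definition pt_frame : frame :=
  Frame pt_le_refl pt_le_trans (@pt_upset _) pt_dot_mono.

(** All the conditions reduce to the semilattice laws of union, with the empty pair as unit. *)
Lemma pt_set_frame : set_frame pt_frame.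
Proof.
have dotE (X Y : set pt) p q : X p -> Y q -> setdot join_dot X Y (join p q).
  by move=> Xp Yq; exists p => //; exists q.
split; [split|] => /=.
- by move=> p q _ ->; rewrite -[in X in _ X](joinpp p) -joinA; apply: dotE.
- by move=> p q r _ [_ -> [_ -> ->]]; rewrite -joinA; apply: dotE.
- move=> p q r _ [_ -> [_ -> ->]].
  by rewrite (joinC p q) -joinA; apply: dotE.
- by move=> p; rewrite /join_dot /= joinpp.
- by move=> p q _ ->; rewrite -[in X in _ X](joinpp q) joinA; apply: dotE.
- by move=> p; rewrite -[in X in _ X](join0p p) joinC; apply: dotE.
- by move=> p q _ ->; rewrite joinC.
- by move=> p _ ->; rewrite joinpp -{2}(join0p p); apply: dotE.
Qed.

Lemma SetFr_sat A (V : nat -> set pt) : SetFr A -> @sat pt_frame V pt0 A.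
Proof. by move/(_ _ pt_set_frame V); apply=> // n; apply: pt_upset. Qed.

End PowersetFrame.

(** * Derivability under premises and prime filters *)

HB.instance Definition _ := gen_eqMixin form.

Section TWJ.
Implicit Types A B C D : form.

Lemma twj_ax A : TWJ_axiom A -> TWJplus A.
Proof. exact: thm_ax. Qed.

Lemma twj_trans A B C : TWJplus (A ⟶ B) -> TWJplus (B ⟶ C) -> TWJplus (A ⟶ C).
Proof. by move=> hAB; apply: thm_mp; apply: thm_mp hAB; apply/twj_ax/ax_suffix. Qed.

Lemma twj_glb A B C :
  TWJplus (A ⟶ B) -> TWJplus (A ⟶ C) -> TWJplus (A ⟶ B ⩓ C).
Proof. by move=> hAB hAC; apply: thm_mp (thm_adj hAB hAC); apply/twj_ax/ax_andI. Qed.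

(** Axioms (4), (7) and (9) have conjunctive antecedents and so act below a common antecedent [A],
    where the rule of modus ponens does not apply. *)
Lemma twj_mp_in A B C D : TWJ_axiom (B ⩓ C ⟶ D) ->
  TWJplus (A ⟶ B) -> TWJplus (A ⟶ C) -> TWJplus (A ⟶ D).
Proof. by move=> hD hB hC; apply: twj_trans (twj_ax hD); apply: twj_glb. Qed.

End TWJ.

Fixpoint vbound (A : form) : nat :=
  match A with
  | Var m => m.+1
  | And A B | Or A B | Imp A B => maxn (vbound A) (vbound B)
  end.

Fixpoint restr (K : nat) (A : form) : form :=
  match A with
  | Var m => Var (if m < K then m else 0)
  | And A B => restr K A ⩓ restr K B
  | Or A B => restr K A ⩔ restr K B
  | Imp A B => restr K A ⟶ restr K B
  end.

Lemma restr_id K A : vbound A <= K -> restr K A = A.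
Proof.
by elim: A => [m|A IA B IB|A IA B IB|A IA B IB] /=; rewrite ?geq_max;
  [move=> ->|move=> /andP[/IA-> /IB->]..].
Qed.

Definition conj : seq form -> form := foldr And (Var 0 ⟶ Var 0).

(** The bound is at least 1, so that [Var 0], onto which [restr] collapses the foreign letters, also
    gets its identity in [prem]. *)
Definition letters (rs : seq form) : nat := foldr (fun A => maxn (vbound A)) 1 rs.

(* TWJ+ does not prove [P ⟶ (A ⟶ A)] in general; the identities on the letters
   of [rs] make it do so for all formulas in these letters. *)
Definition prem (rs : seq form) : form :=
  conj (rs ++ [seq Var m ⟶ Var m | m <- iota 0 (letters rs)]).

Lemma vbound_letters rs A : A \in rs -> vbound A <= letters rs.
Proof.
elim: rs => //= B rs IH; rewrite inE => /predU1P[->|/IH h]; first exact: leq_maxl.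
by apply: leq_trans h _; apply: leq_maxr.
Qed.

Lemma letters_gt0 rs : 0 < letters rs.
Proof. by elim: rs => //= A rs IH; rewrite leq_max IH orbT. Qed.

Lemma conj_mem s A : A \in s -> TWJplus (conj s ⟶ A).
Proof.
elim: s => //= B s IH; rewrite inE => /predU1P[->|/IH].
  exact/twj_ax/ax_andl.
by apply: twj_trans; apply/twj_ax/ax_andr.
Qed.

(* Letters outside [rs] are identified with [Var 0], which makes [le rs]
   reflexive on all formulas. *)
Definition le (rs : seq form) (A B : form) : Prop :=
  TWJplus (prem rs ⟶ (restr (letters rs) A ⟶ restr (letters rs) B)).

Section Order.
Variable rs : seq form.
Implicit Types A B C D : form.
Local Notation "A ≤ B" := (le rs A B) (at level 70).
Local Notation K := (letters rs).
Local Notation "A ^°" := (restr K A) (at level 2, format "A ^°").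

Lemma le_trans A B C : A ≤ B -> B ≤ C -> A ≤ C.
Proof. exact/twj_mp_in/ax_conj_syll. Qed.

(** By induction: the identities on letters are conjuncts of the premise, and the connectives lift
    them. An implication only needs the identity on its consequent, by prefixing. *)
Lemma le_refl A : A ≤ A.
Proof.
rewrite /le; elim: A => [m|A IA B IB|A IA B IB|A _ B IB] /=.
- apply: conj_mem; rewrite mem_cat; apply/orP; right; apply: map_f.
  by rewrite mem_iota add0n; case: ifP => // _; apply: letters_gt0.
- apply: (twj_mp_in (ax_andI _ _ _)); [apply: twj_trans IA _|apply: twj_trans IB _];
    by apply: thm_mp; [apply/twj_ax/ax_suffix|constructor; constructor].
- apply: (twj_mp_in (ax_orE _ _ _)); [apply: twj_trans IA _|apply: twj_trans IB _];
    by apply: thm_mp; [apply/twj_ax/ax_prefix|constructor; constructor].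
- by apply: twj_trans IB _; apply/twj_ax/ax_prefix.
Qed.

(** A theorem cannot simply be weakened by a premise; it is prefixed to the identity [A ⟶ A], which
    the premise does imply. *)
Lemma le_thm A B : TWJplus (A^° ⟶ B^°) -> A ≤ B.
Proof.
move=> h; apply: twj_trans (le_refl A) _; apply: thm_mp h; exact/twj_ax/ax_prefix.
Qed.

Lemma le_ax A B : TWJ_axiom (A^° ⟶ B^°) -> A ≤ B.
Proof. by move=> h; apply/le_thm/twj_ax. Qed.

Lemma le_rule A B : (A ⟶ B) \in rs -> A ≤ B.
Proof.
move=> AB; have /restr_id[eA eB] := vbound_letters AB.
by rewrite /le eA eB; apply: conj_mem; rewrite mem_cat AB.
Qed.

Lemma le_andl A B : A ⩓ B ≤ A. Proof. exact/le_ax/ax_andl. Qed.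
Lemma le_andr A B : A ⩓ B ≤ B. Proof. exact/le_ax/ax_andr. Qed.
Lemma le_orl A B : A ≤ A ⩔ B. Proof. exact/le_ax/ax_orl. Qed.
Lemma le_orr A B : B ≤ A ⩔ B. Proof. exact/le_ax/ax_orr. Qed.

Lemma le_and A B C : C ≤ A -> C ≤ B -> C ≤ A ⩓ B.
Proof. exact/twj_mp_in/ax_andI. Qed.

Lemma le_or A B C : A ≤ C -> B ≤ C -> A ⩔ B ≤ C.
Proof. exact/twj_mp_in/ax_orE. Qed.

Lemma le_distr A B C : A ⩓ (B ⩔ C) ≤ (A ⩓ B) ⩔ (A ⩓ C).
Proof. exact/le_ax/ax_distr. Qed.

Lemma le_prefix A B C : A ⟶ B ≤ (C ⟶ A) ⟶ (C ⟶ B).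
Proof. exact/le_ax/ax_prefix. Qed.

Lemma le_suffix A B C : A ⟶ B ≤ (B ⟶ C) ⟶ (A ⟶ C).
Proof. exact/le_ax/ax_suffix. Qed.

Lemma le_impl A B C : A ≤ B -> B ⟶ C ≤ A ⟶ C.
Proof. by move=> h; apply: twj_trans h _; apply/twj_ax/ax_suffix. Qed.

Lemma le_impr A B C : A ≤ B -> C ⟶ A ≤ C ⟶ B.
Proof. by move=> h; apply: twj_trans h _; apply/twj_ax/ax_prefix. Qed.

Lemma le_imp_and A B C : (C ⟶ A) ⩓ (C ⟶ B) ≤ C ⟶ A ⩓ B.
Proof. exact/le_ax/ax_andI. Qed.

Lemma le_imp_or A B C : (A ⟶ C) ⩓ (B ⟶ C) ≤ A ⩔ B ⟶ C.
Proof. exact/le_ax/ax_orE. Qed.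

(** * Prime filters of the preorder [≤] and links between them *)

Record prime (T : set form) : Prop := Prime {
  prime_up : forall A B, T A -> A ≤ B -> T B;
  prime_and : forall A B, T A -> T B -> T (A ⩓ B);
  prime_or : forall A B, T (A ⩔ B) -> T A \/ T B
}.

(** The prime filter theorem for the distributive preorder [≤]: by Zorn there is a maximal filter
    above [F] that avoids the ideal [I], and maximality makes it prime. *)
Lemma prime_extend (F I : set form) :
  (forall A B, F A -> A ≤ B -> F B) -> (forall A B, F A -> F B -> F (A ⩓ B)) ->
  (forall A B, I B -> A ≤ B -> I A) -> (forall A B, I A -> I B -> I (A ⩔ B)) ->
  (forall A, F A -> ~ I A) ->
  exists T, [/\ prime T, forall A, F A -> T A & forall A, T A -> ~ I A].
Proof.
move=> Fup Fand Idn Ior FI.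
pose ok (T : set form) := [/\ forall A B, T A -> A ≤ B -> T B,
  forall A B, T A -> T B -> T (A ⩓ B), forall A, F A -> T A &
  forall A, T A -> ~ I A].
pose U := {T : set form | ok T}.
pose R (T T' : U) := `[< forall A, sval T A -> sval T' A >].
have F0 : ok F by split.
have [||||[T [Tup Tand FT TI]] Tmax] := @Zorn U R.
- by move=> T; apply/asboolP.
- by move=> T T' T'' /asboolP h /asboolP h'; apply/asboolP => A /h /h'.
- move=> [T hT] [T' hT'] /asboolP h /asboolP h'; apply: eq_exist; apply: funext => A.
  by apply/propext; split; [apply: h|apply: h'].
(* The union of an empty chain need not contain [F]; such a chain is bounded by [F] itself. *)
- move=> C Ctot; have [[T0 CT0]|noC] := pselect (exists T, C T); last first.
    by exists (exist _ F F0) => T CT; case: noC; exists T.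
  have hok : ok (fun A => exists2 T : U, C T & sval T A).
    split.
    + move=> A B [T CT TA] AB; exists T => //; case: (svalP T) => up _ _ _.
      exact: up TA AB.
    + move=> A B [T CT TA] [T' CT' T'B].
      have [/asboolP TT'|/asboolP T'T] := Ctot _ _ CT CT'.
        by exists T' => //; case: (svalP T') => _ ad _ _; apply: ad => //; apply: TT'.
      by exists T => //; case: (svalP T) => _ ad _ _; apply: ad => //; apply: T'T.
    + by move=> A FA; exists T0 => //; case: (svalP T0) => _ _ h _; apply: h.
    + by move=> A [T _ TA]; case: (svalP T) => _ _ _; apply.
  by exists (exist _ _ hok) => T CT; apply/asboolP => A TA; exists T.
exists T; split=> //; split=> // A B TAB; apply: contrapT => /not_orP[nA nB].
(* By maximality, the filter generated by [T] and [D] meets the ideal. *)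
have meet D : ~ T D -> exists G J, [/\ T G, I J & G ⩓ D ≤ J].
  move=> nD; apply: contrapT => noGJ; apply: nD.
  pose T' : set form := fun E => exists2 G, T G & G ⩓ D ≤ E.
  have TT' E : T E -> T' E by move=> TE; exists E => //; apply: le_andl.
  have T'ok : ok T'.
    split.
    + by move=> E E' [G TG GE] EE'; exists G => //; apply: le_trans EE'.
    + move=> E E' [G TG GE] [G' TG' GE']; exists (G ⩓ G'); first exact: (Tand _ _ TG TG').
      apply: le_and; [apply: le_trans GE|apply: le_trans GE'];
        apply: le_and; try exact: le_andr; apply: le_trans (le_andl _ _) _;
        [exact: le_andl|exact: le_andr].
    + by move=> E FE; apply/TT'; exact: (FT _ FE).
    + by move=> E [G TG GE] IE; apply: noGJ; exists G, E; split.
  have : exist _ T' T'ok = exist ok T (And4 Tup Tand FT TI).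
    by apply: Tmax; apply/asboolP.
  (* Some element of [T] must witness that [D] is in [T']; [A ⩔ B] is at hand. *)
  move=> /(congr1 sval) /= <-; exists (A ⩔ B) => //; exact: le_andr.
have [G [J [TG IJ GJ]]] := meet _ nA.
have [G' [J' [TG' IJ' GJ']]] := meet _ nB.
have := TI (J ⩔ J'); apply; last exact: Ior.
(* Distributivity splits the conjunction along [A ⩔ B]; the halves lie below [J] and [J']. *)
apply: (Tup _ _ (Tand _ _ (Tand _ _ TG TG') TAB)); apply: le_trans (le_distr _ _ _) _.
apply: le_or; [apply: le_trans (le_orl _ _)|apply: le_trans (le_orr _ _)];
  [apply: le_trans GJ|apply: le_trans GJ']; apply: le_and; try exact: le_andr;
  apply: le_trans (le_andl _ _) _; [exact: le_andl|exact: le_andr].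
Qed.

(* [link r T T'] says that [T'] lies in a product of [T] with the point that [r]
   describes: on the right if [r = rlink W], on the left if [r = llink Y]. *)
Definition link (r : form -> form -> Prop) (T T' : set form) : Prop :=
  forall A B, T A -> r A B -> T' B.

Definition rlink (W A B : form) : Prop := A ≤ W ⟶ B.
Definition llink (Y A B : form) : Prop := Y ≤ A ⟶ B.

(** [hom_and] makes the image of a prime filter a filter; [hom_or] makes the formulas related to
    something outside a prime filter an ideal. *)
Record hom (r : form -> form -> Prop) : Prop := Hom {
  hom_mono : forall A A' B B', A' ≤ A -> r A B -> B ≤ B' -> r A' B';
  hom_and : forall A A' B B', r A B -> r A' B' -> r (A ⩓ A') (B ⩓ B');
  hom_or : forall A A' B B', r A B -> r A' B' -> r (A ⩔ A') (B ⩔ B')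
}.

Lemma hom_rlink W : hom (rlink W).
Proof.
split.
- move=> A A' B B' AA' AB BB'; apply: le_trans AA' (le_trans AB _).
  exact: le_impr.
- move=> A A' B B' AB AB'; apply: le_trans (le_imp_and _ _ _); apply: le_and.
    exact: le_trans (le_andl _ _) AB.
  exact: le_trans (le_andr _ _) AB'.
- move=> A A' B B' AB AB'; apply: le_or.
    by apply: le_trans AB _; apply/le_impr/le_orl.
  by apply: le_trans AB' _; apply/le_impr/le_orr.
Qed.

Lemma hom_llink Y : hom (llink Y).
Proof.
split.
- move=> A A' B B' AA' AB BB'; apply: le_trans AB _.
  by apply: le_trans (le_impl _ AA'); apply: le_impr.
- move=> A A' B B' AB AB'; apply: le_trans (le_imp_and _ _ _); apply: le_and.
    by apply: le_trans AB _; apply/le_impl/le_andl.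
  by apply: le_trans AB' _; apply/le_impl/le_andr.
- move=> A A' B B' AB AB'; apply: le_trans (le_imp_or _ _ _); apply: le_and.
    by apply: le_trans AB _; apply/le_impr/le_orl.
  by apply: le_trans AB' _; apply/le_impr/le_orr.
Qed.

(* Axiom (10) for [s = llink W'] and axiom (11) for [s = rlink W']. *)
Lemma link_swap (s : form -> form -> Prop) Y W A B C : s = llink Y \/ s = rlink Y ->
  rlink W A B -> llink Y B C -> exists2 D, s A D & rlink W D C.
Proof.
move=> hs AB BC; exists (W ⟶ C); last exact: le_refl.
case: hs => ->.
  apply: le_trans BC _; apply: le_trans (le_prefix _ _ W) _; exact: le_impl.
apply: le_trans AB _; apply: le_trans (le_suffix _ _ C) _; exact: le_impl.
Qed.

Definition image (r : form -> form -> Prop) (T : set form) : set form :=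
  fun B => exists2 A, T A & r A B.

Lemma image_up r T A B : hom r -> image r T A -> A ≤ B -> image r T B.
Proof.
by move=> hr [C TC rC] AB; exists C => //; apply: hom_mono (le_refl C) rC AB.
Qed.

Lemma image_and r T A B : hom r -> prime T ->
  image r T A -> image r T B -> image r T (A ⩓ B).
Proof.
move=> hr hT [C TC rC] [D TD rD]; exists (C ⩓ D); first exact: prime_and.
exact: hom_and.
Qed.

(** [prime_extend] separates the image of [T] from the principal ideal of [D]. *)
Lemma link_push r T D : hom r -> prime T -> (forall A, T A -> ~ r A D) ->
  exists T', [/\ prime T', link r T T' & ~ T' D].
Proof.
move=> hr hT TD.
have [|||||T' [pT' TT' T'D]] := @prime_extend (image r T) (fun A => A ≤ D).
- by move=> A B; apply: image_up.
- by move=> A B; apply: image_and.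
- by move=> A B BD /le_trans; apply.
- by move=> A B; apply: le_or.
- move=> A [B TB rB] AD; apply: TD TB _; exact: hom_mono (le_refl B) rB AD.
exists T'; split=> //; first by move=> A B TA rAB; apply: TT'; exists A.
by move/T'D; apply; apply: le_refl.
Qed.

(** [Z'] must contain the image of [T] under [s] and avoid every formula that [r] relates to
    something outside [Z]. The hypothesis says that these two sets are disjoint. *)
Lemma link_pull r (s : form -> form -> Prop) T Z :
  hom r -> hom s -> prime T -> prime Z ->
  (forall A B C, T A -> s A B -> r B C -> Z C) ->
  exists Z', [/\ prime Z', link s T Z' & link r Z' Z].
Proof.
move=> hr hs hT hZ TZ.
have [|||||Z' [pZ' TZ' Z'Z]] :=
  @prime_extend (image s T) (fun A => exists2 B, r A B & ~ Z B).
- by move=> A B; apply: image_up.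
- by move=> A B; apply: image_and.
- move=> A B [C rC ZC] AB; exists C => //; exact: hom_mono AB rC (le_refl C).
- move=> A B [C rC ZC] [D rD ZD]; exists (C ⩔ D); first exact: hom_or.
  by move/(prime_or hZ) => [].
- by move=> A [B TB sB] [C rC []]; apply: TZ TB sB rC.
exists Z'; split=> //; first by move=> A B TA rAB; apply: TZ'; exists A.
by move=> A B ZA rAB; apply: contrapT => ZB; apply: Z'Z ZA _; exists B.
Qed.

End Order.

(** * Programs and their formulas *)

Inductive com : Type :=
| Inc of nat
| Dec of nat
| Seq of com & com
| While of nat & com.

HB.instance Definition _ := gen_eqMixin com.

Inductive op : Type := OpInc of nat | OpDec of nat | OpNop.

HB.instance Definition _ := gen_eqMixin op.

Definition upd (f : nat -> nat) (r a : nat) : nat -> nat :=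
  fun r' => if r' == r then a else f r'.

Definition apply_op (o : op) (f : nat -> nat) : nat -> nat :=
  match o with
  | OpInc r => upd f r (f r).+1
  | OpDec r => upd f r (f r).-1
  | OpNop => f
  end.

(* A state is the list of commands that remain to be executed. *)
Definition state_op (s : seq com) : op :=
  match s with
  | Inc r :: _ => OpInc r
  | Dec r :: _ => OpDec r
  | _ => OpNop
  end.

Definition state_next (s : seq com) (f : nat -> nat) : seq com :=
  match s with
  | [::] => [::]
  | Inc _ :: k | Dec _ :: k => k
  | Seq c d :: k => c :: d :: k
  | While r c :: k => if f r == 0 then k else c :: s
  end.

(* In the state [(m, s)] with [m > 0] the machine is still loading its input:
   register 0 is incremented whenever [m] is even, and [s] starts at [m = 0]. *)
Definition loader_op (e : nat * seq com) : op :=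
  if e.1 is m.+1 then if odd m then OpInc 0 else OpNop else state_op e.2.

Definition loader_next (e : nat * seq com) (f : nat -> nat) : nat * seq com :=
  if e.1 is m.+1 then (m, e.2) else (0, state_next e.2 f).

Definition config : Type := ((nat * seq com) * (nat -> nat))%type.

Definition step (c : config) : config :=
  (loader_next c.1 c.2, apply_op (loader_op c.1) c.2).

(* Columns of the grid are numbered by space and rows by time. [LX] and [LT] mark
   the parity of the column and of the row; [LJX] and [LJT] are their
   complements. At column [x], [LC r] and [LN r] say that [x] is, resp. is not,
   smaller than the content of register [r]; [LPC], [LPN] refer to the previous
   and [LFC], [LFN] to the following column. *)
Inductive letter : Type :=
| LY of bool | LW of bool | LX of bool | LT of bool | LJX of bool | LJT of bool
| LCol0 | LRow0
| LC of nat | LN of nat | LPC of nat | LPN of nat | LFC of nat | LFN of nat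
| LInc of nat | LDec of nat | LNop
| LQ of nat.

Definition tag (l : letter) : nat * nat :=
  match l with
  | LY b => (0, nat_of_bool b) | LW b => (1, nat_of_bool b)
  | LX b => (2, nat_of_bool b) | LT b => (3, nat_of_bool b)
  | LJX b => (4, nat_of_bool b) | LJT b => (5, nat_of_bool b)
  | LCol0 => (6, 0) | LRow0 => (7, 0)
  | LC r => (8, r) | LN r => (9, r) | LPC r => (10, r) | LPN r => (11, r)
  | LFC r => (12, r) | LFN r => (13, r) | LInc r => (14, r) | LDec r => (15, r)
  | LNop => (16, 0) | LQ i => (17, i)
  end.

Lemma tag_inj : injective tag.
Proof.
by do 2!case=> [[]|[]|[]|[]|[]|[]| | |?|?|?|?|?|?|?|?| |?]; move=> //= [->].
Qed.

(* Opaque, lest unification computes in unary. *)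
Lemma letter_code : {f : letter -> nat | injective f}.
Proof.
exists (pickle \o tag); apply: inj_comp tag_inj; exact: pcan_inj pickleK.
Qed.

Definition lcode : letter -> nat := sval letter_code.

Lemma lcode_inj : injective lcode.
Proof. exact: svalP letter_code. Qed.

Coercion lvar (l : letter) : form := Var (lcode l).

Definition opf (o : op) : form :=
  match o with OpInc r => LInc r | OpDec r => LDec r | OpNop => LNop end.

Definition touches (o : op) (r : nat) : bool :=
  match o with OpInc r' | OpDec r' => r' == r | OpNop => false end.

Definition colored (f : bool -> bool -> seq form) : seq form :=
  f false false ++ f false true ++ f true false ++ f true true.

Definition at_color (i j : bool) (A : form) : form := A ⩓ LX i ⩓ LT j.

(* The horizontal rule comes in two forms since the letter [LY] acts on the right
   in the first row and on the left in the other ones. *)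
Definition hrule (AB : form * form) : seq form :=
  let: (A, B) := AB in
  colored (fun i j =>
    [:: at_color i j A ⟶ (LY (~~ i) ⟶ B ⩔ LJX (~~ i));
        LY (~~ i) ⟶ (at_color i j A ⟶ B ⩔ LJX (~~ i))]).

Definition vrule (AB : form * form) : seq form :=
  let: (A, B) := AB in
  colored (fun i j => [:: at_color i j A ⟶ (LW (~~ j) ⟶ B ⩔ LJT (~~ j))]).

Definition prule (AB : form * form) : seq form :=
  let: (A, B) := AB in colored (fun i j => [:: at_color i j A ⟶ B]).

(** In place of falsity, which the positive language does not contain, a forbidden formula implies
    the junk letter of the current row, which no cell satisfies. *)
Definition crule (A : form) : seq form :=
  colored (fun i j => [:: at_color i j A ⟶ LJT j]).

(** In the model, this is the complement of the cells in even rows and in columns of parity [i]. *)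
Definition goal (i : bool) : form := LJX i ⩔ LJT false.

(** In order: growth to the right, used in the bottom row; growth upwards; alternation of the column
    parity and of the row parity; constancy of the row parity along the bottom row and of the column
    parity along columns; propagation of row junk to the right; conversion of column junk at a cell
    into row junk. *)
Definition grid_rules : seq form :=
  colored (fun i j =>
    [:: (LY (~~ i) ⟶ goal (~~ i)) ⟶ goal i;
        (LW (~~ j) ⟶ LJT (~~ j)) ⟶ LJT j;
        LX i ⟶ (LY (~~ i) ⟶ LX (~~ i) ⩔ LJX (~~ i));
        LT j ⟶ (LW (~~ j) ⟶ LT (~~ j) ⩔ LJT (~~ j));
        LT false ⟶ (LY i ⟶ LT false);
        LX i ⟶ (LW j ⟶ LX i);
        LY i ⟶ (LJT j ⟶ LJT j);
        at_color i j (LJX i) ⟶ LJT j]).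

Section Rules.
Variables (R : nat) (Q : seq (seq com)).

Definition regs : seq nat := iota 0 R.

Definition ops : seq op := OpNop :: map OpInc regs ++ map OpDec regs.

Definition state (s : seq com) : form := LQ (index s Q).

Definition state_rules (s : seq com) : seq (form * form) :=
  match s with
  | [::] => [::]
  | Inc _ :: k | Dec _ :: k => [:: (state s, state k)]
  | Seq c d :: k => [:: (state s, state (c :: d :: k))]
  | While r c :: k => [:: (state s ⩓ LC r, state (c :: s)); (state s ⩓ LN r, state k)]
  end.

(** The operation spreads along its row. [LPC] and [LPN] carry a register bit one column to the
    right; [LFC] and [LFN] predict the bit of the next column, and the prediction is delivered
    there. *)
Definition hrules : seq (form * form) :=
  (lvar LRow0, lvar LRow0) :: [seq (opf o, opf o) | o <- ops] ++
  flatten [seq [:: (lvar (LC r), lvar (LPC r)); (lvar (LN r), lvar (LPN r));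
                   (lvar (LFC r), lvar (LC r)); (lvar (LFN r), lvar (LN r))]
          | r <- regs].

Definition keep_rules (o : op) (r : nat) : seq (form * form) :=
  if touches o r then [::]
  else [:: (opf o ⩓ LC r, lvar (LC r)); (opf o ⩓ LN r, lvar (LN r))].

(** In unary, an increment shifts the bits of the register one column to the right and fills column
    0, and a decrement shifts them one column to the left. *)
Definition vrules : seq (form * form) :=
  (lvar LCol0, lvar LCol0) ::
  flatten [seq [:: (LInc r ⩓ LCol0, lvar (LC r)); (LInc r ⩓ LPC r, lvar (LC r));
                   (LInc r ⩓ LPN r, lvar (LN r)); (LDec r ⩓ LFC r, lvar (LC r));
                   (LDec r ⩓ LFN r, lvar (LN r))]
          | r <- regs] ++
  flatten [seq flatten [seq keep_rules o r | r <- regs] | o <- ops] ++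
  flatten [seq state_rules s | s <- Q].

Definition prules : seq (form * form) :=
  [seq (lvar LRow0, lvar (LN r)) | r <- regs] ++
  [seq (lvar (LDec r), LFC r ⩔ LFN r) | r <- regs] ++
  [seq (state s, opf (state_op s)) | s <- Q].

Definition crules : seq form := state [::] :: [seq LC r ⩓ LN r | r <- regs].

(* The load command: [loading m B] holds at column 0 if the machine is going to
   load for [m] steps and then to satisfy [B]. *)
Fixpoint loading (m : nat) (B : form) : form :=
  if m is m'.+1 then
    (if odd m' then LInc 0 else LNop) ⩓
    (LW (odd m') ⟶ loading m' B ⩔ LJT (odd m'))
  else B.

Definition start (m : nat) : form :=
  LX false ⩓ LT false ⩓ LCol0 ⩓ LRow0 ⩓ loading m (LQ 0).

(* The first rule is trivially valid: it lists the letters of [start m] for all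
   even [m]. *)
Definition rules : seq form :=
  (start 2 ⟶ start 2) :: grid_rules ++ flatten (map hrule hrules) ++
  flatten (map vrule vrules) ++ flatten (map prule prules) ++
  flatten (map crule crules).

End Rules.

Definition reduct (R : nat) (Q : seq (seq com)) (m : nat) : form :=
  prem (rules R Q) ⟶ (start m ⟶ goal false).

(** * A halting run yields a derivation *)

Lemma colored_mem (f : bool -> bool -> seq form) i j A : A \in f i j -> A \in colored f.
Proof. by rewrite /colored !mem_cat; case: i; case: j => ->; rewrite ?orbT. Qed.

Section Derivation.
Variables (R : nat) (Q : seq (seq com)).

Local Notation rs := (rules R Q).
Local Notation "A ≤ B" := (le rs A B) (at level 70).

Lemma mem_rules C : (C \in rs) = [|| C == (start 2 ⟶ start 2), C \in grid_rules,
  C \in flatten (map hrule (hrules R)), C \in flatten (map vrule (vrules R Q)),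
  C \in flatten (map prule (prules R Q)) | C \in flatten (map crule (crules R Q))].
Proof.
have cat5 (a : form) s1 s2 s3 s4 s5 : (C \in a :: s1 ++ s2 ++ s3 ++ s4 ++ s5) =
    [|| C == a, C \in s1, C \in s2, C \in s3, C \in s4 | C \in s5].
  by rewrite inE !mem_cat.
exact: cat5.
Qed.

Lemma mem_grid_rules C : C \in grid_rules -> C \in rs.
Proof. by move=> h; rewrite mem_rules h orbT. Qed.

Lemma mem_hrule A B C : (A, B) \in hrules R -> C \in hrule (A, B) -> C \in rs.
Proof.
move=> h hC; suff hC' : C \in flatten (map hrule (hrules R)).
  by rewrite mem_rules hC' !orbT.
by apply/flatten_mapP; exists (A, B).
Qed.

Lemma mem_vrule A B C : (A, B) \in vrules R Q -> C \in vrule (A, B) -> C \in rs.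
Proof.
move=> h hC; suff hC' : C \in flatten (map vrule (vrules R Q)).
  by rewrite mem_rules hC' !orbT.
by apply/flatten_mapP; exists (A, B).
Qed.

Lemma mem_prule A B C : (A, B) \in prules R Q -> C \in prule (A, B) -> C \in rs.
Proof.
move=> h hC; suff hC' : C \in flatten (map prule (prules R Q)).
  by rewrite mem_rules hC' !orbT.
by apply/flatten_mapP; exists (A, B).
Qed.

Lemma mem_crule A C : A \in crules R Q -> C \in crule A -> C \in rs.
Proof.
move=> h hC; suff hC' : C \in flatten (map crule (crules R Q)).
  by rewrite mem_rules hC' !orbT.
by apply/flatten_mapP; exists A.
Qed.

Lemma mem_cons_cat2 (T : eqType) (a b : T) s1 s2 :
  (a \in b :: s1 ++ s2) = [|| a == b, a \in s1 | a \in s2].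
Proof. by rewrite inE mem_cat. Qed.

Lemma mem_cons_cat3 (T : eqType) (a b : T) s1 s2 s3 :
  (a \in b :: s1 ++ s2 ++ s3) = [|| a == b, a \in s1, a \in s2 | a \in s3].
Proof. by rewrite inE !mem_cat. Qed.

Lemma mem_cat3 (T : eqType) (a : T) s1 s2 s3 :
  (a \in s1 ++ s2 ++ s3) = [|| a \in s1, a \in s2 | a \in s3].
Proof. by rewrite !mem_cat. Qed.

(** The bottom row grows by [link_push] along [rlink]; the higher rows come from [link_pull], whose
    squares close with [llink]. *)
Definition row_link (t : nat) (Y : form) : form -> form -> Prop :=
  if t == 0 then rlink rs Y else llink rs Y.

Record row (N t : nat) (T : nat -> set form) : Prop := Row {
  row_prime : forall x, x <= N -> prime rs (T x);
  row_X : forall x, x <= N -> T x (LX (odd x));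
  row_T : forall x, x <= N -> T x (LT (odd t));
  row_JT : forall x, x <= N -> ~ T x (LJT (odd t));
  row_linked : forall x, x < N -> link (row_link t (LY (odd x.+1))) (T x) (T x.+1)
}.

Lemma row_color N t T x A : row N t T -> x <= N -> T x A ->
  T x (at_color (odd x) (odd t) A).
Proof.
move=> hT xN TA; apply: (prime_and (row_prime hT xN)); last exact: (row_T hT xN).
by apply: (prime_and (row_prime hT xN)); last exact: (row_X hT xN).
Qed.

Lemma row_prule N t T x A B : row N t T -> x <= N -> (A, B) \in prules R Q ->
  T x A -> T x B.
Proof.
move=> hT xN AB TA; apply: (prime_up (row_prime hT xN) (row_color hT xN TA)).
apply/le_rule/(mem_prule AB)/(@colored_mem _ (odd x) (odd t)).
by rewrite inE.
Qed.

Lemma row_crule N t T x A : row N t T -> x <= N -> A \in crules R Q -> ~ T x A.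
Proof.
move=> hT xN hA TA; apply: (row_JT hT xN).
apply: (prime_up (row_prime hT xN) (row_color hT xN TA)).
apply/le_rule/(mem_crule hA)/(@colored_mem _ (odd x) (odd t)).
by rewrite inE.
Qed.

Lemma row_not_JX N t T x : row N t T -> x <= N -> ~ T x (LJX (odd x)).
Proof.
move=> hT xN TJ; apply: (row_JT hT xN).
apply: (prime_up (row_prime hT xN) (row_color hT xN TJ)).
apply/le_rule/mem_grid_rules/(@colored_mem _ (odd x) (odd t)).
by rewrite !inE eqxx !orbT.
Qed.

(** The link yields [B ⩔ LJX], and the junk disjunct is excluded in a row. *)
Lemma row_hrule N t T x A B : row N t T -> x < N -> (A, B) \in hrules R ->
  T x A -> T x.+1 B.
Proof.
move=> hT xN AB TA.
have [] // : T x.+1 B \/ T x.+1 (LJX (odd x.+1)); last first.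
  by move/(row_not_JX hT).
apply: (prime_or (row_prime hT xN)).
apply: (row_linked hT xN (row_color hT (ltnW xN) TA)); rewrite /row_link.
case: ifP => _; apply/le_rule/(mem_hrule AB)/(@colored_mem _ (odd x) (odd t));
  by rewrite !inE eqxx ?orbT.
Qed.

Lemma row_hrule_all N t T x A : row N t T -> x <= N -> (A, A) \in hrules R ->
  T 0 A -> T x A.
Proof.
by move=> hT + AA T0; elim: x => // x IH xN; apply: (row_hrule hT xN AA); apply/IH/ltnW.
Qed.

Lemma row_vrule N t T T' x A B : row N t T -> row N t.+1 T' -> x <= N ->
  link (rlink rs (LW (odd t.+1))) (T x) (T' x) ->
  (A, B) \in vrules R Q -> T x A -> T' x B.
Proof.
move=> hT hT' xN TT' AB TA.
have [] // : T' x B \/ T' x (LJT (odd t.+1)); last by move/(row_JT hT').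
apply: (prime_or (row_prime hT' xN)); apply: TT' (row_color hT xN TA) _.
apply/le_rule/(mem_vrule AB)/(@colored_mem _ (odd x) (odd t)).
by rewrite inE.
Qed.

(** The row grows from the left: its last filter avoids [goal], so the growth rule and [link_push]
    give it a successor that avoids the next [goal] and with it both kinds of junk. *)
Lemma row0_exists N S : S ≤ LX false -> S ≤ LT false -> ~ S ≤ goal false ->
  exists2 T, row N 0 T & T 0 S.
Proof.
move=> SX ST Sg; suff [T [hT TS _]] : exists T, [/\ row N 0 T, T 0 S &
  ~ T N (goal (odd N))] by exists T.
elim: N => [|N [T [hT TS TN]]].
  have [|||||T [pT ST' Tg]] :=
    @prime_extend rs (fun B => S ≤ B) (fun B => B ≤ goal false).
  - by move=> A B /le_trans; apply.
  - by move=> A B; apply: le_and.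
  - by move=> A B h /le_trans; apply.
  - by move=> A B; apply: le_or.
  - by move=> A SA /(le_trans SA).
  have Tng : ~ T (goal false) by move/Tg; apply; apply: le_refl.
  exists (fun=> T); split=> //; last by apply/ST'/le_refl.
  split=> // x; first by rewrite leqn0 => /eqP->; apply: ST'.
    by move=> _; apply: ST'.
  by move=> _ TJ; apply/Tng/(prime_up pT TJ)/le_orr.
have pT := row_prime hT (leqnn N).
have [|Z [pZ TZ Zg]] := link_push (D := goal (odd N.+1)) (hom_rlink rs (LY (odd N.+1))) pT.
  move=> A TA Ag; apply: TN; apply: (prime_up pT (prime_up pT TA Ag)).
  apply/le_rule/mem_grid_rules/(@colored_mem _ (odd N) false).
  by rewrite inE eqxx.
exists (fun x => if x <= N then T x else Z); rewrite ltnn; split=> //.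
split=> [x|x|x|x|x].
- by case: (leqP x N) => // xN _; apply: (row_prime hT xN).
- case: (leqP x N) => [xN _|Nx xN]; first exact: (row_X hT xN).
  have {x Nx xN}-> : x = N.+1 by apply/eqP; rewrite eqn_leq xN.
  have [] // : Z (LX (odd N.+1)) \/ Z (LJX (odd N.+1)); last first.
    by move=> ZJ; case: Zg; apply/(prime_up pZ ZJ)/le_orl.
  apply: (prime_or pZ); apply: TZ (row_X hT (leqnn N)) _.
  apply/le_rule/mem_grid_rules/(@colored_mem _ (odd N) false).
  by rewrite !inE eqxx ?orbT.
- case: (leqP x N) => [xN _|_ _]; first exact: (row_T hT xN).
  apply: TZ (row_T hT (leqnn N)) _.
  apply/le_rule/mem_grid_rules/(@colored_mem _ (odd N.+1) false).
  by rewrite !inE eqxx ?orbT.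
- case: (leqP x N) => [xN _|_ _]; first exact: (row_JT hT xN).
  by move=> ZJ; case: Zg; apply/(prime_up pZ ZJ)/le_orr.
- rewrite ltnS => xN; rewrite xN; case: (ltnP x N) => [xN'|Nx].
    exact: (row_linked hT xN').
  by have -> : x = N by apply/eqP; rewrite eqn_leq xN.
Qed.

(* The new row is pulled back along the given one, from its right end [Z]. *)
Lemma row_above t T n Z W : (forall x, x <= n -> prime rs (T x)) ->
  (forall x, x < n -> link (row_link t (LY (odd x.+1))) (T x) (T x.+1)) ->
  prime rs Z -> link (rlink rs W) (T n) Z ->
  exists T', [/\ T' n = Z,
    forall x, x <= n -> prime rs (T' x),
    forall x, x <= n -> link (rlink rs W) (T x) (T' x) &
    forall x, x < n -> link (llink rs (LY (odd x.+1))) (T' x) (T' x.+1)].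
Proof.
elim: n Z => [|n IH] Z pT lT pZ TZ.
  by exists (fun=> Z); split=> // x; rewrite leqn0 => /eqP->.
have [A B C TA AB BC|Z' [pZ' TZ' Z'Z]] :=
  link_pull (hom_llink rs (LY (odd n.+1))) (hom_rlink rs W) (pT n (leqnSn n)) pZ.
  (* Moving right and then up already leads to [Z]; the swap replaces moving up and then right by
     that path. *)
  have [|D AD DC] := link_swap (s := row_link t (LY (odd n.+1))) _ AB BC.
    by rewrite /row_link; case: ifP => _; [right|left].
  by apply: TZ DC; apply: lT TA AD.
have [||||T' [T'n pT' lT' hT']] := IH Z'.
- by move=> x xn; apply: pT; apply: leqW.
- by move=> x xn; apply: lT; apply: leqW.
- by [].
- by [].
exists (fun x => if x <= n then T' x else Z); rewrite ltnn; split=> [//|x|x|x].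
- by case: (leqP x n) => // xn _; apply: pT'.
- case: (leqP x n) => [xn _|nx xn]; first exact: lT'.
  by have -> : x = n.+1 by apply/eqP; rewrite eqn_leq xn.
- rewrite ltnS => xn; rewrite xn; case: (ltnP x n) => [xn'|nx]; first exact: hT'.
  by have -> : x = n; [apply/eqP; rewrite eqn_leq xn|rewrite T'n].
Qed.

Lemma row_next N t T : row N t T -> exists2 T', row N t.+1 T' &
  forall x, x <= N -> link (rlink rs (LW (odd t.+1))) (T x) (T' x).
Proof.
move=> hT; have pT := row_prime hT (leqnn N).
have [|Z [pZ TZ ZJ]] :=
  link_push (D := LJT (odd t.+1)) (hom_rlink rs (LW (odd t.+1))) pT.
  move=> A TA Ag; apply: (row_JT hT (leqnn N)).
  apply: (prime_up pT (prime_up pT TA Ag)).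
  apply/le_rule/mem_grid_rules/(@colored_mem _ (odd N) (odd t)).
  by rewrite !inE eqxx ?orbT.
have [T' [T'N pT' lT' hT']] := row_above (row_prime hT) (row_linked hT) pZ TZ.
(* Row junk propagates to the right, so its absence at the right end excludes it everywhere in the
   row. *)
have T'J x : x <= N -> ~ T' x (LJT (odd t.+1)).
  move=> xN T'J; apply: ZJ; rewrite -T'N -(subnKC xN).
  have: x + (N - x) <= N by rewrite subnKC.
  elim: (N - x) => [|d IH] xdN; first by rewrite addn0.
  rewrite addnS in xdN *; apply: (hT' _ xdN) (IH (ltnW xdN)) _.
  apply/le_rule/mem_grid_rules/(@colored_mem _ (odd (x + d).+1) (odd t.+1)).
  by rewrite !inE eqxx ?orbT.
exists T' => //; split=> // x xN.
- apply: lT' (row_X hT xN) _ => //.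
  apply/le_rule/mem_grid_rules/(@colored_mem _ (odd x) (odd t.+1)).
  by rewrite !inE eqxx ?orbT.
- have [] // : T' x (LT (odd t.+1)) \/ T' x (LJT (odd t.+1)); last by move/(T'J _ xN).
  apply: (prime_or (pT' _ xN)); apply: lT' (row_T hT xN) _ => //.
  apply/le_rule/mem_grid_rules/(@colored_mem _ (odd x) (odd t)).
  by rewrite !inE eqxx ?orbT.
Qed.

(** * Simulation of a run along the rows *)

Record closed_states : Prop := Closed {
  regs_gt0 : 0 < R;
  closed_nil : [::] \in Q;
  closed_next : forall s f, s \in Q -> state_next s f \in Q;
  closed_op : forall s, s \in Q -> state_op s \in ops R;
  closed_test : forall r c k, While r c :: k \in Q -> r < R
}.

Hypothesis HQ : closed_states.

Lemma loader_op_mem e : e.2 \in Q -> loader_op e \in ops R.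
Proof.
case: e => -[|m] s /= sQ; first exact: (closed_op HQ).
rewrite /loader_op /=; case: ifP => _; rewrite !inE ?eqxx //=.
by rewrite mem_cat map_f ?orbT // mem_iota (regs_gt0 HQ).
Qed.

(** The registers are known on the columns up to [n] only. Each step loses one column, since a
    decrement consults the column to the right. *)
Record represents (t : nat) (T : nat -> set form) (n : nat) (c : config) : Prop :=
  Represents {
    repr_col0 : T 0 LCol0;
    repr_state : T 0 (loading c.1.1 (state Q c.1.2));
    repr_parity : 0 < c.1.1 -> odd t = odd c.1.1;
    repr_mem : c.1.2 \in Q;
    repr_reg : forall x r, x <= n -> r < R -> T x (if x < c.2 r then LC r else LN r)
  }.

Section Step.
Variables (N t n : nat) (T T' : nat -> set form) (c : config).
Hypotheses (hT : row N t T) (hT' : row N t.+1 T') (nN : n < N).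
Hypothesis TT' : forall x, x <= N -> link (rlink rs (LW (odd t.+1))) (T x) (T' x).
Hypothesis hc : represents t T n.+1 c.

Let e := c.1.
Let f := c.2.
Let o := loader_op e.

Let pT x : x <= N -> prime rs (T x). Proof. exact: (row_prime hT). Qed.

Let T_and x A B : x <= N -> T x A -> T x B -> T x (A ⩓ B).
Proof. by move=> xN; apply: (prime_and (pT xN)). Qed.

Let vert x A B : x <= N -> (A, B) \in vrules R Q -> T x A -> T' x B.
Proof. by move=> xN; apply: (row_vrule hT hT' xN (TT' xN)). Qed.

Lemma op_row x : x <= N -> T x (opf o).
Proof.
move=> xN; apply: (row_hrule_all hT xN).
  rewrite mem_cons_cat2; apply/or3P/Or32.
  by apply/mapP; exists o => //; apply/loader_op_mem/(repr_mem hc).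
have := repr_state hc; have := repr_mem hc; rewrite /o /e.
case: (c.1) => -[|m] s /= sQ; rewrite /loader_op /=.
  apply: (row_prule hT (leq0n N)); rewrite mem_cat3; apply/or3P/Or33.
  exact: (map_f (fun s => (state Q s, opf (state_op s)))).
move/(prime_up (pT (leq0n N))) => /(_ _ (le_andl _ _ _)).
by case: ifP.
Qed.

Lemma step_keep x r : x <= n -> r < R -> ~~ touches o r ->
  T' x (if x < f r then LC r else LN r).
Proof.
move=> xn rR or; have xN : x <= N by rewrite (leq_trans xn) // ltnW.
have keep A B : (A, B) \in keep_rules o r -> T x A -> T' x B.
  move=> AB; apply: (vert xN); rewrite mem_cons_cat3.
  apply/or4P/Or43/flatten_mapP; exists o; first exact/loader_op_mem/(repr_mem hc).
  by apply/flatten_mapP; exists r; rewrite // mem_iota.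
have Tr := repr_reg hc (leqW xn) rR; rewrite -/f in Tr.
case: ifP Tr => _ Tr; apply: (keep _ _ _ (T_and xN (op_row xN) Tr));
  by rewrite /keep_rules (negbTE or) !inE eqxx ?orbT.
Qed.

Let reg_vrule r A B : r < R ->
  (A, B) \in [:: (LInc r ⩓ LCol0, lvar (LC r)); (LInc r ⩓ LPC r, lvar (LC r));
                 (LInc r ⩓ LPN r, lvar (LN r)); (LDec r ⩓ LFC r, lvar (LC r));
                 (LDec r ⩓ LFN r, lvar (LN r))] -> (A, B) \in vrules R Q.
Proof.
move=> rR AB; rewrite mem_cons_cat3.
by apply/or4P/Or42/flatten_mapP; exists r; rewrite // mem_iota.
Qed.

Let reg_hrule r A B : r < R ->
  (A, B) \in [:: (lvar (LC r), lvar (LPC r)); (lvar (LN r), lvar (LPN r));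
                 (lvar (LFC r), lvar (LC r)); (lvar (LFN r), lvar (LN r))] ->
  (A, B) \in hrules R.
Proof.
move=> rR AB; rewrite mem_cons_cat2; apply/or3P/Or33.
by apply/flatten_mapP; exists r; rewrite // mem_iota.
Qed.

Lemma step_inc x r : x <= n -> r < R -> o = OpInc r ->
  T' x (if x < (f r).+1 then LC r else LN r).
Proof.
move=> xn rR or; have xN : x <= N by rewrite (leq_trans xn) // ltnW.
have := op_row xN; rewrite or /=.
case: x => [|x] in xn xN * => To.
  apply: (vert xN (reg_vrule rR _) (T_and xN To (repr_col0 hc))).
  by rewrite !inE eqxx.
have Tr := repr_reg hc (leqW (ltnW xn)) rR; rewrite -/f in Tr.
rewrite ltnS; case: ifP Tr => _ Tr.
  have TP : T x.+1 (LPC r).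
    by apply: (row_hrule hT xN (reg_hrule rR _) Tr); rewrite !inE eqxx.
  by apply: (vert xN (reg_vrule rR _) (T_and xN To TP)); rewrite !inE eqxx ?orbT.
have TP : T x.+1 (LPN r).
  by apply: (row_hrule hT xN (reg_hrule rR _) Tr); rewrite !inE eqxx ?orbT.
by apply: (vert xN (reg_vrule rR _) (T_and xN To TP)); rewrite !inE eqxx ?orbT.
Qed.

(** Primeness chooses a prediction [LFC] or [LFN] for the next column. It is correct because it is
    delivered there, where [LC] and [LN] exclude each other. *)
Lemma step_dec x r : x <= n -> r < R -> o = OpDec r ->
  T' x (if x < (f r).-1 then LC r else LN r).
Proof.
move=> xn rR or; have xN : x < N by apply: leq_ltn_trans nN.
have := op_row (ltnW xN); rewrite or /= => To.
have Tr := repr_reg hc (_ : x.+1 <= n.+1) rR; rewrite -/f in Tr.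
have clash : ~ T x.+1 (LC r ⩓ LN r).
  apply: (row_crule hT xN); rewrite inE; apply/orP; right.
  by apply: (map_f (fun r => LC r ⩓ LN r)); rewrite mem_iota.
have [] : T x (LFC r) \/ T x (LFN r).
  apply: (prime_or (pT (ltnW xN))); apply: (row_prule hT (ltnW xN)) To.
  rewrite mem_cat3; apply/or3P/Or32.
  by apply: (map_f (fun r => (lvar (LDec r), LFC r ⩔ LFN r))); rewrite mem_iota.
- move=> TF; have TC : T x.+1 (LC r).
    by apply: (row_hrule hT xN (reg_hrule rR _) TF); rewrite !inE eqxx ?orbT.
  rewrite ltn_predRL; case: ifP (Tr xn) => _ Tr'.
    by apply: (vert (ltnW xN) (reg_vrule rR _) (T_and (ltnW xN) To TF));
      rewrite !inE eqxx ?orbT.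
  by case: clash; apply: T_and.
- move=> TF; have TN : T x.+1 (LN r).
    by apply: (row_hrule hT xN (reg_hrule rR _) TF); rewrite !inE eqxx ?orbT.
  rewrite ltn_predRL; case: ifP (Tr xn) => _ Tr'; first by case: clash; apply: T_and.
  by apply: (vert (ltnW xN) (reg_vrule rR _) (T_and (ltnW xN) To TF));
    rewrite !inE eqxx ?orbT.
Qed.

Lemma represents_step : represents t.+1 T' n (step c).
Proof.
have vstate A B : (A, B) \in flatten [seq state_rules Q s | s <- Q] ->
    T 0 A -> T' 0 B.
  move=> AB; apply: (vert (leq0n N)); rewrite mem_cons_cat3.
  exact/or4P/Or44.
have sQ := repr_mem hc; have Ts := repr_state hc; have hp := repr_parity hc.
have T0r := fun r => repr_reg hc (leq0n n.+1) (r := r).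
split.
- by apply: (vert (leq0n N) _ (repr_col0 hc)); rewrite inE eqxx.
- rewrite /step /=; rewrite -/e -/f in sQ Ts hp T0r *.
  case: e Ts sQ hp => -[|m] s /= Ts sQ hp; last first.
    have [] // : T' 0 (loading m (state Q s)) \/ T' 0 (LJT (odd m)).
      apply: (prime_or (row_prime hT' (leq0n N))).
      apply: (TT' (leq0n N) (prime_up (pT (leq0n N)) Ts (le_andr _ _ _))).
      by rewrite /= hp //= negbK; apply: le_refl.
    by have := row_JT hT' (leq0n N); rewrite /= hp //= negbK.
  have rule B C : (B, C) \in state_rules Q s -> T 0 B -> T' 0 C.
    by move=> h; apply: vstate; apply/flatten_mapP; exists s.
  case: s Ts sQ hp rule => [|[r|r|c' d|r c'] k] /= Ts sQ hp rule.
  + by have := row_crule hT (leq0n N) (mem_head _ _) Ts.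
  + by apply: rule Ts; rewrite inE.
  + by apply: rule Ts; rewrite inE.
  + by apply: rule Ts; rewrite inE.
  + have := T0r _ (closed_test HQ sQ).
    rewrite lt0n; case: eqP => _ Tr; apply: (rule _ _ _ (T_and (leq0n N) Ts Tr));
      by rewrite !inE eqxx ?orbT.
- move: hp; rewrite /step /= -/e; case: e => -[|m] s //= hp m0.
  by rewrite hp //= negbK.
- rewrite /step /=; move: sQ; rewrite -/e -/f; case: e => -[|m] s //=.
  exact: (closed_next HQ).
- move=> x r xn rR; rewrite /step /= -/e -/f -/o.
  have [or|] := boolP (touches o r); last first.
    move=> or; have := step_keep xn rR or.
    by case: o or => //= r'; rewrite /upd eq_sym => /negbTE ->.
  case: o (step_inc xn rR) (step_dec xn rR) or => //= r' hi hd /eqP r'r;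
    rewrite r'r /upd eqxx in hi hd *; [exact: hi|exact: hd].
Qed.

End Step.

Lemma vbound_start m : vbound (start m) <= letters rs.
Proof.
have : vbound (start 2) <= letters rs.
  by apply: leq_trans (vbound_letters (mem_head _ _)); apply: leq_maxl.
move: (letters rs) => K; rewrite /start /= !geq_max -!andbA.
case/and5P=> -> -> -> ->.
case/and5P=> h1 h2 h3 h4 /and3P[h5 h6 h7] /=.
elim: m => //= m IH; rewrite !geq_max IH.
by case: (odd m); apply/and4P; split.
Qed.

Lemma vbound_goal : vbound (goal false) <= letters rs.
Proof.
have /mem_grid_rules/vbound_letters : ((LY true ⟶ goal true) ⟶ goal false) \in grid_rules.
  by apply: (@colored_mem _ false false); rewrite inE eqxx.
by rewrite {1}/vbound -/vbound geq_max => /andP[].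
Qed.

Lemma halting_reduct m s0 : ~~ odd m -> s0 \in Q -> index s0 Q = 0 ->
  (exists t, (iter t step ((m, s0), fun=> 0)).1 = (0, [::])) ->
  TWJplus (reduct R Q m).
Proof.
move=> m2 s0Q i0 [N halt]; apply: contrapT => nthm.
(* The halting time [N] also serves as the width: with one column lost per step, column 0 is still
   known at time [N]. *)
have [|||T0 hT0 T0S] := @row0_exists N (start m).
- by do 4!apply: le_trans (le_andl _ _ _) _; apply: le_refl.
- by do 3!apply: le_trans (le_andl _ _ _) _; apply: le_andr.
- by rewrite /le !restr_id ?vbound_start ?vbound_goal.
have p0 := row_prime hT0 (leq0n N).
have r0 : represents 0 T0 N ((m, s0), fun=> 0).
  split=> //=.
  - by move/(prime_up p0): T0S; apply; do 2!apply: le_trans (le_andl _ _ _) _; apply: le_andr.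
  - by rewrite /state i0; move/(prime_up p0): T0S; apply; apply: le_andr.
  - by rewrite (negbTE m2).
  - move=> x r xN rR; apply: (row_prule (A := LRow0) hT0 xN).
      rewrite mem_cat3; apply/or3P/Or31.
      by apply: (map_f (fun r => (lvar LRow0, lvar (LN r)))); rewrite mem_iota.
    apply: (row_hrule_all hT0 xN); first by rewrite inE eqxx.
    by move/(prime_up p0): T0S; apply; apply: le_trans (le_andl _ _ _) _; apply: le_andr.
have main d : d <= N -> exists2 T, row N d T &
    represents d T (N - d) (iter d step ((m, s0), fun=> 0)).
  elim: d => [|d IH] dN; first by exists T0; rewrite ?subn0.
  have [T hT rT] := IH (ltnW dN).
  have [T' hT' TT'] := row_next hT; exists T' => //.
  rewrite iterS; apply: (represents_step hT hT') => //.
    by rewrite ltn_subrL /= (leq_trans _ dN).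
  by rewrite subnSK.
have [T hT rT] := main _ (leqnn N).
have := repr_state rT; rewrite halt /=.
by apply: (row_crule hT); rewrite ?inE ?eqxx.
Qed.

End Derivation.

(** * An infinite run yields a countermodel *)

Definition below (n : nat) : set nat := [set k | k < n]%classic.

Lemma below_inj : injective below.
Proof.
move=> a b ab; apply/eqP; rewrite eqn_leq (leqNgt a) (leqNgt b).
apply/andP; split; apply/negP => h.
  by have : below a b by []; rewrite ab /below /= ltnn.
by have : below b a by []; rewrite -ab /below /= ltnn.
Qed.

Lemma belowS n : (below n `|` [set n])%classic = below n.+1.
Proof.
apply/funext => k; apply/propext; rewrite /below /= ltnS (leq_eqVlt k n); split.
  by case=> ->; rewrite ?eqxx ?orbT.
by case/predU1P; [right|left].
Qed.

Lemma belowU1 a b n : (below a `|` [set n])%classic = below b ->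
  b = a \/ b = a.+1 /\ n = a.
Proof.
move=> ab; have ab' k : (k < b) = (k < a) || (k == n).
  apply/idP/idP => h.
    have : below b k by [].
    by rewrite -ab => -[->|->]; rewrite ?eqxx ?orbT.
  suff : below b k by [].
  by rewrite -ab; case/orP: h => [|/eqP]; [left|right].
have nb : n < b by rewrite ab' eqxx orbT.
have leab : a <= b by rewrite leqNgt; apply/negP => ba; have := ab' b; rewrite ltnn ba.
have := ab' a; rewrite ltnn /=; case: eqP => [an|_] /=; last first.
  by move=> ab0; left; apply/eqP; rewrite eqn_leq leab leqNgt ab0.
move=> ab0; right; split=> //; apply/eqP; rewrite eqn_leq ab0 andbT.
rewrite leqNgt; apply/negP => h; have := ab' a.+1.
by rewrite h ltnNge leqnSn -an gtn_eqF.
Qed.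

Section Model.
Variables (R : nat) (Q : seq (seq com)) (m : nat) (s0 : seq com).
Hypotheses (HQ : closed_states R Q) (m_even : ~~ odd m) (i0 : index s0 Q = 0).

Let conf (t : nat) : config := iter t step ((m, s0), fun=> 0).

Hypothesis no_halt : forall t, (conf t).1 <> (0, [::]).


(** At column 0 the missing previous column counts as filled ([LPC] holds, [LPN] fails), in
    accordance with the increment rule. *)
Definition lab (l : letter) (x t : nat) : Prop :=
  let: (e, f) := conf t in
  match l with
  | LCol0 => x = 0
  | LRow0 => t = 0
  | LC r => x < f r
  | LN r => f r <= x
  | LPC r => x <= f r
  | LPN r => f r < x
  | LFC r => x.+1 < f r
  | LFN r => f r <= x.+1
  | LInc r => loader_op e = OpInc r
  | LDec r => loader_op e = OpDec r
  | LNop => loader_op e = OpNop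
  | LQ i => [/\ x = 0, e.1 = 0 & index e.2 Q = i]
  | _ => False
  end.

Definition cell (x t : nat) : pt := (below x, below t).

(** A singleton [{n}] has the parity of [n.+1], the length of the segment that it completes. *)
Definition lsat (l : letter) (p : pt) : Prop :=
  match l with
  | LY b => exists2 n, odd n.+1 = b & p = ([set n]%classic, set0)
  | LW b => exists2 n, odd n.+1 = b & p = (set0, [set n]%classic)
  | LX b => exists2 x, odd x = b & p.1 = below x
  | LT b => exists2 t, odd t = b & p.2 = below t
  | LJX b => ~ exists2 x, odd x = b & p.1 = below x
  | LJT b => ~ exists2 t, odd t = b & p.2 = below t
  | _ => exists x t, p = cell x t /\ lab l x t
  end.

Definition grid_val (n : nat) : set pt := fun p => exists2 l, lcode l = n & lsat l p.

Local Notation "p ⊩ A" := (@sat pt_frame grid_val p A) (at level 70).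

Lemma val_letter (l : letter) p : p ⊩ l <-> lsat l p.
Proof. by split=> [[l' /lcode_inj ->]|h] //; exists l. Qed.

Lemma cell_inj x t x' t' : cell x t = cell x' t' -> x = x' /\ t = t'.
Proof. by case=> /below_inj-> /below_inj->. Qed.

Definition cell_letter (l : letter) : bool :=
  match l with LY _ | LW _ | LX _ | LT _ | LJX _ | LJT _ => false | _ => true end.

Lemma cellP (l : letter) x t : cell_letter l -> cell x t ⊩ l <-> lab l x t.
Proof.
move=> hl; apply: iff_trans (val_letter _ _) _.
have -> : lsat l (cell x t) = exists x' t', cell x t = cell x' t' /\ lab l x' t'.
  by case: l hl.
by split=> [[x' [t' [/cell_inj[-> ->]]]]|h] //; exists x, t.
Qed.

Lemma cell_lab l x t : grid_val (lcode l) (cell x t) -> cell_letter l -> lab l x t.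
Proof. by move=> h hl; apply/(cellP _ _ hl). Qed.

Lemma sat0_imp A B : pt0 ⊩ (A ⟶ B) <-> forall p, p ⊩ A -> p ⊩ B.
Proof.
split=> [h p pA|h p q pA ->]; last by rewrite join0p; apply: h.
by apply: h pA _; rewrite /= /join_dot /= join0p.
Qed.

Lemma sat_at_color p i j A : p ⊩ at_color i j A ->
  exists x t, [/\ p = cell x t, odd x = i, odd t = j & p ⊩ A].
Proof.
move=> [[pA /val_letter[x xi px]] /val_letter[t tj pt]]; exists x, t; split=> //.
by case: (p) px pt => a b /= -> ->.
Qed.

Lemma colored_sound f C : (forall i j C, C \in f i j -> pt0 ⊩ C) ->
  C \in colored f -> pt0 ⊩ C.
Proof.
by rewrite /colored !mem_cat => h /or4P[] /h.
Qed.

Lemma not_JX b p : ~ p ⊩ LJX b -> exists2 x, odd x = b & p.1 = below x.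
Proof. by move=> h; apply: contrapT => h'; apply/h/val_letter. Qed.

Lemma not_JT b p : ~ p ⊩ LJT b -> exists2 t, odd t = b & p.2 = below t.
Proof. by move=> h; apply: contrapT => h'; apply/h/val_letter. Qed.

(** A result that is not junk is a segment of parity opposite to [x]. It therefore differs from the
    old segment, and [belowU1] leaves only the extension by one. *)
Lemma move_right x t n : odd n.+1 = ~~ odd x ->
  join (cell x t) ([set n]%classic, set0) = cell x.+1 t \/
  join (cell x t) ([set n]%classic, set0) ⊩ LJX (~~ odd x).
Proof.
move=> hn; have [] := pselect (join (cell x t) ([set n]%classic, set0) ⊩ LJX (~~ odd x)).
  by right.
move/not_JX => -[x' hx' /= h]; left.
have [e|[_ nx]] := belowU1 h; first by move: hx'; rewrite e; case: odd.
by rewrite /join /= nx setU0 belowS.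
Qed.

Lemma move_up x t n : odd n.+1 = ~~ odd t ->
  join (cell x t) (set0, [set n]%classic) = cell x t.+1 \/
  join (cell x t) (set0, [set n]%classic) ⊩ LJT (~~ odd t).
Proof.
move=> hn; have [] := pselect (join (cell x t) (set0, [set n]%classic) ⊩ LJT (~~ odd t)).
  by right.
move/not_JT => -[t' ht' /= h]; left.
have [e|[_ nt]] := belowU1 h; first by move: ht'; rewrite e; case: odd.
by rewrite /join /= nt setU0 belowS.
Qed.

Lemma hrule_sound A B C : (forall x t, cell x t ⊩ A -> cell x.+1 t ⊩ B) ->
  C \in hrule (A, B) -> pt0 ⊩ C.
Proof.
move=> h; apply: colored_sound => i j D; rewrite !inE => /orP[] /eqP->; apply/sat0_imp.
- move=> _ /sat_at_color[x [t [-> <- _ /h hB]]] _ q /val_letter[n hn ->] ->.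
  by have [->|hJ] := move_right t hn; [left|right].
- move=> _ /val_letter[n hn ->] _ q /sat_at_color[x [t [-> xi _ /h hB]]] ->.
  rewrite -xi in hn *; rewrite joinC.
  by have [->|hJ] := move_right t hn; [left|right].
Qed.

Lemma vrule_sound A B C : (forall x t, cell x t ⊩ A -> cell x t.+1 ⊩ B) ->
  C \in vrule (A, B) -> pt0 ⊩ C.
Proof.
move=> h; apply: colored_sound => i j D; rewrite inE => /eqP->; apply/sat0_imp.
move=> _ /sat_at_color[x [t [-> _ <- /h hB]]] _ q /val_letter[n hn ->] ->.
by have [->|hJ] := move_up x hn; [left|right].
Qed.

Lemma prule_sound A B C : (forall x t, cell x t ⊩ A -> cell x t ⊩ B) ->
  C \in prule (A, B) -> pt0 ⊩ C.
Proof.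
move=> h; apply: colored_sound => i j D; rewrite inE => /eqP->; apply/sat0_imp.
by move=> _ /sat_at_color[x [t [-> _ _ /h hB]]].
Qed.

Lemma crule_sound A C : (forall x t, ~ cell x t ⊩ A) -> C \in crule A -> pt0 ⊩ C.
Proof.
move=> h; apply: colored_sound => i j D; rewrite inE => /eqP->; apply/sat0_imp.
by move=> _ /sat_at_color[x [t [-> _ _ /h]]].
Qed.

(** For the growth rules, a point that refutes the conclusion has a segment of some length [x] in
    the coordinate concerned; joining the singleton [{x}] gives the next segment, which refutes the
    antecedent. *)
Lemma grid_rules_sound C : C \in grid_rules -> pt0 ⊩ C.
Proof.
apply: colored_sound => i j D; rewrite !inE.
do ![case/predU1P=> [->|]]; [..|move/eqP->]; apply/sat0_imp => p.
- move=> hp; apply: contrapT => /not_orP[/not_JX[x xi px] /not_JT[t t0 pt]].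
  have [] : goal (~~ i) = goal (~~ i) /\ join p ([set x]%classic, set0) ⊩ goal (~~ i).
    split=> //; apply: (hp ([set x]%classic, set0)); last by [].
    by apply/val_letter; exists x; rewrite //= xi.
  rewrite /join /= px pt setU0 belowS => _ [] /val_letter; apply.
    by exists x.+1; rewrite //= xi.
  by exists t.
- move=> hp; apply: contrapT => /not_JT[t tj pt].
  have : join p (set0, [set t]%classic) ⊩ LJT (~~ j).
    apply: (hp (set0, [set t]%classic)); last by [].
    by apply/val_letter; exists t; rewrite //= tj.
  move/val_letter; apply; exists t.+1; first by rewrite /= tj.
  by rewrite /join /= pt belowS.
- move=> _ q r _ _; have [h|/not_JX h] := pselect (r ⊩ LJX (~~ i)); first by right.
  by left; apply/val_letter.
- move=> _ q r _ _; have [h|/not_JT h] := pselect (r ⊩ LJT (~~ j)); first by right.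
  by left; apply/val_letter.
- move=> /val_letter[t t0 pt] _ q /val_letter[n _ ->] ->.
  by apply/val_letter; exists t; rewrite //= setU0.
- move=> /val_letter[x xi px] _ q /val_letter[n _ ->] ->.
  by apply/val_letter; exists x; rewrite //= setU0.
- move=> /val_letter[n _ ->] q r /val_letter qJ ->.
  by apply/val_letter => -[t tj h]; apply: qJ; exists t => //; rewrite -h /= set0U.
- move=> /sat_at_color[x [t [-> xi _ /val_letter []]]].
  by exists x.
Qed.

Lemma confS t : conf t.+1 = step (conf t).
Proof. exact: iterS. Qed.

Lemma regE t r : (conf t.+1).2 r = apply_op (loader_op (conf t).1) (conf t).2 r.
Proof. by rewrite confS. Qed.

Lemma labE l x t : lab l x t =
  match l with
  | LCol0 => x = 0
  | LRow0 => t = 0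
  | LC r => x < (conf t).2 r
  | LN r => (conf t).2 r <= x
  | LPC r => x <= (conf t).2 r
  | LPN r => (conf t).2 r < x
  | LFC r => x.+1 < (conf t).2 r
  | LFN r => (conf t).2 r <= x.+1
  | LInc r => loader_op (conf t).1 = OpInc r
  | LDec r => loader_op (conf t).1 = OpDec r
  | LNop => loader_op (conf t).1 = OpNop
  | LQ i => [/\ x = 0, (conf t).1.1 = 0 & index (conf t).1.2 Q = i]
  | _ => False
  end.
Proof. by rewrite /lab; case: (conf t). Qed.

Lemma cell_op o x t : cell x t ⊩ opf o <-> loader_op (conf t).1 = o.
Proof.
by case: o => [r|r|]; apply: iff_trans (cellP _ _ _) _; rewrite // labE.
Qed.

Lemma cell_state s x t : s \in Q -> cell x t ⊩ state Q s <->
  x = 0 /\ (conf t).1 = (0, s).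
Proof.
move=> sQ; apply: iff_trans (cellP _ _ _) _; rewrite // labE.
case: (conf t).1 => k s'; split=> [[-> /= -> i]|[-> [-> ->]]] //; split=> //.
have s'Q : s' \in Q by rewrite -index_mem i index_mem.
by rewrite -(nth_index [::] s'Q) i nth_index.
Qed.

Lemma hrules_sound A B x t : (A, B) \in hrules R -> cell x t ⊩ A -> cell x.+1 t ⊩ B.
Proof.
rewrite mem_cons_cat2 => /or3P[/eqP[-> ->]|/mapP[o _ [-> ->]]|].
- by move=> /cellP; rewrite labE => h; apply/cellP; rewrite ?labE //; apply: h.
- by move/cell_op => h; apply/cell_op.
- move=> /flatten_mapP[r _]; rewrite !inE.
  do ![case/predU1P=> [[-> ->]|]]; last move/eqP=> [-> ->].
  all: by move=> /cellP; rewrite labE => /(_ isT) h; apply/cellP; rewrite ?labE.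
Qed.

Lemma vrules_sound A B x t : (A, B) \in vrules R Q -> cell x t ⊩ A -> cell x t.+1 ⊩ B.
Proof.
rewrite mem_cons_cat3 => /or4P[/eqP[-> ->]|||].
- by move=> /cellP; rewrite labE => h; apply/cellP; rewrite ?labE //; apply: h.
{ move=> /flatten_mapP[r _]; rewrite !inE.
  do ![case/predU1P=> [[-> ->]|]]; last move/eqP=> [-> ->].
  all: case=> h1 h2; have := cell_lab h1 isT; have := cell_lab h2 isT.
  all: rewrite !labE => h ho; apply/cellP; rewrite // labE regE ho /= /upd eqxx.
  - by rewrite h.
  - by rewrite ltnS.
  - by [].
  - by rewrite ltn_predRL.
  - by rewrite -subn1 leq_subLR add1n. }
- move=> /flatten_mapP[o _] /flatten_mapP[r _]; rewrite /keep_rules.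
  case: ifP => // or; rewrite !inE => /orP[] /eqP[-> ->] [/cell_op ho] /cellP;
    rewrite labE => /(_ isT) h; apply/cellP; rewrite // labE regE ho;
    by case: o or {ho} => //= r'; rewrite /upd eq_sym => ->.
- move=> /flatten_mapP[s sQ]; have := closed_next HQ _ sQ.
  have next s' : s' \in Q -> cell x t ⊩ state Q s -> state_next s (conf t).2 = s' ->
      cell x t.+1 ⊩ state Q s'.
    move=> s'Q /(cell_state _ _ sQ)[x0 ht] hs; apply/cell_state => //; split=> //.
    by rewrite confS /step ht /loader_next /= hs.
  case: s sQ next => [|[r|r|c d|r c] k] sQ next nQ //=; rewrite !inE.
  + by move=> /eqP[-> ->] h; apply: next h _ => //; apply: (nQ (fun=> 0)).
  + by move=> /eqP[-> ->] h; apply: next h _ => //; apply: (nQ (fun=> 0)).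
  + by move=> /eqP[-> ->] h; apply: next h _ => //; apply: (nQ (fun=> 0)).
  + case/orP=> /eqP[-> ->] [h /cellP]; rewrite labE => /(_ isT) hr; apply: (next _ _ h).
    (* The constant contents 1 and 0 select the two branches of the loop. *)
    * exact: (nQ (fun=> 1)).
    * by rewrite /= gtn_eqF // (leq_ltn_trans _ hr).
    * exact: (nQ (fun=> 0)).
    (* A state letter holds at column 0 only, where [LN r] says that the register is empty. *)
    * have [x0 _] := (cell_state _ _ sQ).1 h.
      by move: hr; rewrite /= x0 leqn0 => ->.
Qed.

Lemma prules_sound A B x t : (A, B) \in prules R Q -> cell x t ⊩ A -> cell x t ⊩ B.
Proof.
rewrite mem_cat3 => /or3P[/mapP[r _ [-> ->]]|/mapP[r _ [-> ->]]|/mapP[s sQ [-> ->]]].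
- move=> /cellP; rewrite labE => /(_ isT) t0; apply/cellP; rewrite // labE.
  by rewrite t0.
- move=> _; have [h|h] := ltnP x.+1 ((conf t).2 r); [left|right];
    by apply/cellP; rewrite // labE.
- by move=> /(cell_state _ _ sQ)[_ h]; apply/cell_op; rewrite h.
Qed.

Lemma crules_sound A x t : A \in crules R Q -> ~ cell x t ⊩ A.
Proof.
rewrite inE => /predU1P[-> /(cell_state _ _ (closed_nil HQ))[_]|/mapP[r _ ->]].
  exact: no_halt.
case=> h1 h2; have := cell_lab h2 isT; have := cell_lab h1 isT.
by rewrite !labE ltnNge => /negP.
Qed.

Lemma rules_sound C : C \in rules R Q -> pt0 ⊩ C.
Proof.
rewrite mem_rules => /or4P[/eqP->|||/or3P[]].
- exact/sat0_imp.
- exact: grid_rules_sound.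
- move=> /flatten_mapP[[A B] AB]; apply: hrule_sound => x t; exact: hrules_sound.
- move=> /flatten_mapP[[A B] AB]; apply: vrule_sound => x t; exact: vrules_sound.
- move=> /flatten_mapP[[A B] AB]; apply: prule_sound => x t; exact: prules_sound.
- move=> /flatten_mapP[A hA]; apply: crule_sound => x t; exact: crules_sound.
Qed.

Lemma prem_sound : pt0 ⊩ prem (rules R Q).
Proof.
rewrite /prem.
have : forall C, C \in rules R Q ++ [seq Var k ⟶ Var k | k <- iota 0 (letters (rules R Q))] ->
    pt0 ⊩ C.
  move=> C; rewrite mem_cat => /orP[|/mapP[k _ ->]]; first exact: rules_sound.
  exact/sat0_imp.
elim: (_ ++ _) => [|C s IH] h; first exact/sat0_imp.
by split; [apply/h/mem_head|apply: IH => D Ds; apply: h; rewrite inE Ds orbT].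
Qed.

Lemma conf_loading k t : k + t = m -> (conf t).1 = (k, s0).
Proof.
elim: t k => [|t IH] k; first by rewrite addn0 => ->.
by rewrite addnS -addSn => /IH ht; rewrite confS /step ht.
Qed.

Lemma sat_loading k t : k + t = m -> cell 0 t ⊩ loading k (LQ 0).
Proof.
elim: k t => [|k IH] t kt /=.
  by apply/cellP; rewrite // labE (conf_loading kt) i0.
have par : odd t = ~~ odd k.
  by move: m_even; rewrite -kt addSn /= negbK oddD; case: odd; case: odd.
split.
  have := conf_loading kt; move=> ht.
  have [_ h] := cell_op (loader_op (conf t).1) 0 t; have {h} := h erefl.
  by rewrite {1}ht /loader_op /=; case: ifP.
move=> p q /val_letter[n hn ->] ->.
have [|->|hJ] := @move_up 0 t n.
- by rewrite hn par negbK.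
- by left; apply: IH; rewrite addnS -addSn.
- by right; rewrite par negbK in hJ.
Qed.

(** The unit of the frame is the origin of the grid. It satisfies the premise and [start], but it is
    a cell with both coordinates even and so refutes [goal false]. *)
Lemma reduct_refuted : ~ pt0 ⊩ reduct R Q m.
Proof.
have c0 : pt0 = cell 0 0.
  by rewrite /cell; congr (_, _); apply/funext => k; apply/propext; split.
move=> /sat0_imp /(_ _ prem_sound) /sat0_imp /(_ pt0) [].
- rewrite c0; split; last by apply: sat_loading; rewrite addn0.
  split; last by apply/cellP; rewrite ?labE.
  split; last by apply/cellP; rewrite ?labE.
  by split; apply/val_letter; exists 0.
- by rewrite c0 => /val_letter; apply; exists 0.
- by rewrite c0 => /val_letter; apply; exists 0.
Qed.

End Model.

(** * Executions *)

(** These states cover a run of [c] with continuation [k], up to but excluding [k] itself. *)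
Fixpoint com_states (c : com) (k : seq com) : seq (seq com) :=
  (c :: k) :: match c with
  | Inc _ | Dec _ => [::]
  | Seq c1 c2 => com_states c1 (c2 :: k) ++ com_states c2 k
  | While _ d => com_states d (c :: k)
  end.

Lemma com_states_head c k : c :: k \in com_states c k.
Proof. by case: c => *; rewrite inE eqxx. Qed.

Lemma com_states_next c k s f :
  s \in com_states c k -> state_next s f \in k :: com_states c k.
Proof.
elim: c k => [r|r|c1 IH1 c2 IH2|r d IH] k.
- by rewrite mem_seq1 => /eqP->; apply: mem_head.
- by rewrite mem_seq1 => /eqP->; apply: mem_head.
- rewrite inE mem_cat => /or3P[/eqP->|/IH1|/IH2]; rewrite !inE /= ?mem_cat.
  + by rewrite com_states_head !orbT.
  + by case/predU1P => [->|->]; rewrite ?com_states_head !orbT.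
  + by case/predU1P => [->|->]; rewrite ?eqxx ?orbT.
- rewrite inE; case/predU1P => [->|/IH]; rewrite !inE /= -/com_states.
    by case: (f r == 0); rewrite ?com_states_head ?eqxx ?orbT.
  by case/predU1P => [->|->]; rewrite ?eqxx ?orbT.
Qed.

Fixpoint com_bound (c : com) : nat :=
  match c with
  | Inc r | Dec r => r.+1
  | Seq c1 c2 => maxn (com_bound c1) (com_bound c2)
  | While r d => maxn r.+1 (com_bound d)
  end.

Lemma com_states_bound R c k s : s \in com_states c k ->
  com_bound c <= R -> all (fun d => com_bound d <= R) k ->
  all (fun d => com_bound d <= R) s.
Proof.
elim: c k => [r|r|c1 IH1 c2 IH2|r d IH] k.
- by rewrite mem_seq1 => /eqP-> /= -> ->.
- by rewrite mem_seq1 => /eqP-> /= -> ->.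
- rewrite inE mem_cat => sc c12 hk; have := c12; rewrite /= geq_max => /andP[h1 h2].
  have hk2 : all (fun d => com_bound d <= R) (c2 :: k) by rewrite /= h2.
  case/or3P: sc => [/eqP->|/IH1|/IH2]; [|exact|exact].
  by rewrite /= geq_max h1 h2.
- rewrite inE => sc hd hk; case/predU1P: sc => [->|/IH]; first by apply/andP.
  by apply; [apply: leq_trans hd; apply: leq_maxr|apply/andP].
Qed.

(** The initial state is repeated at the head of the list to get index 0, the index that [start]
    mentions. *)
Lemma closed_states_exist c : exists R Q,
  closed_states R ([:: c] :: Q).
Proof.
(* The successor ensures that register 0 exists for the loader. *)
pose R := (com_bound c).+1; exists R.
pose Q := [::] :: com_states c [::].
have closedQ s f : s \in Q -> state_next s f \in Q.
  by rewrite inE => /predU1P[->|/com_states_next]; first exact: mem_head.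
have boundQ s : s \in Q -> all (fun d => com_bound d <= R) s.
  by rewrite inE => /predU1P[->//|/com_states_bound]; apply=> //; apply: leqnSn.
exists Q.
have QE s : (s \in [:: c] :: Q) = (s \in Q).
  rewrite inE; case: eqP => // ->; rewrite /= inE; apply/esym/orP; right.
  exact: com_states_head.
split=> // [s f|s|r d k].
- by rewrite !QE; apply: closedQ.
- rewrite QE => /boundQ.
  case: s => [|[r|r|c1 c2|r d] k] => [_|/andP[rR _]|/andP[rR _]|_|_] /=;
    try exact: mem_head.
    by rewrite mem_cons_cat2 map_f ?orbT // mem_iota.
  by rewrite mem_cons_cat2 (map_f OpDec) ?orbT // mem_iota.
- by rewrite QE => /boundQ /=; rewrite geq_max => /andP[/andP[]].
Qed.

Definition sstep (c : seq com * (nat -> nat)) : seq com * (nat -> nat) :=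
  (state_next c.1 c.2, apply_op (state_op c.1) c.2).

(** Quantification over the continuation [k] makes executions composable. *)
Definition exec (c : com) (f g : nat -> nat) : Prop :=
  forall k, exists t, iter t sstep (c :: k, f) = (k, g).

Lemma iter_step t s f : iter t step ((0, s), f) =
  ((0, (iter t sstep (s, f)).1), (iter t sstep (s, f)).2).
Proof. by elim: t => //= t ->. Qed.

Lemma iter_step_load m s f :
  iter m.*2 step ((m.*2, s), f) = ((0, s), upd f 0 (f 0 + m)).
Proof.
elim: m f => [|m IH] f /=.
  by congr pair; apply/funext => r; rewrite /upd addn0; case: eqP => // ->.
rewrite -!iterS !iterSr /step /loader_op /loader_next /= odd_double /= IH.
by congr pair; apply/funext => r; rewrite /upd /= addSnnS; case: eqP.
Qed.

Lemma iterD_eq (T : Type) (f : T -> T) x y z t u :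
  iter t f x = y -> iter u f y = z -> iter (u + t) f x = z.
Proof. by move=> xy yz; rewrite iterD xy. Qed.

Lemma exec_inc r f : exec (Inc r) f (upd f r (f r).+1).
Proof. by move=> k; exists 1. Qed.

Lemma exec_dec r f : exec (Dec r) f (upd f r (f r).-1).
Proof. by move=> k; exists 1. Qed.

Lemma exec_seq c d f g h : exec c f g -> exec d g h -> exec (Seq c d) f h.
Proof.
move=> fg gh k; have [t ht] := fg (d :: k); have [u hu] := gh k.
by exists (u + t).+1; rewrite iterSr; apply: iterD_eq ht hu.
Qed.

Lemma exec_while0 r c f : f r = 0 -> exec (While r c) f f.
Proof. by move=> f0 k; exists 1; rewrite /= /sstep /= f0. Qed.

Lemma exec_whileS r c f g h : f r != 0 ->
  exec c f g -> exec (While r c) g h -> exec (While r c) f h.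
Proof.
move=> f0 fg gh k; have [t ht] := fg (While r c :: k); have [u hu] := gh k.
exists (u + t).+1; rewrite iterSr; apply: iterD_eq hu.
by rewrite /sstep /= (negbTE f0).
Qed.

Definition triple (P : (nat -> nat) -> Prop) (c : com) (P' : (nat -> nat) -> Prop) :=
  forall f, P f -> exists2 g, exec c f g & P' g.

(** The invariant is indexed by the number of completed rounds and forces the test to fail after
    exactly [n] of them, whence termination. *)
Lemma triple_while r c n (I : nat -> (nat -> nat) -> Prop) :
  (forall i f, i <= n -> I i f -> (f r == 0) = (i == n)) ->
  (forall i, i < n -> triple (I i) c (I i.+1)) ->
  triple (I 0) (While r c) (I n).
Proof.
move=> Ir Ic f I0.
suff main i : i <= n -> exists2 g, I i g &
    forall h, exec (While r c) g h -> exec (While r c) f h.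
  have [g Ig gf] := main n (leqnn n); exists g => //.
  by apply/gf/exec_while0/eqP; rewrite (Ir n).
elim: i => [|i IH] i_n; first by exists f.
have [g Ig gf] := IH (ltnW i_n); have [g' gg' Ig'] := Ic _ i_n _ Ig.
exists g' => // h g'h; apply: gf; apply: exec_whileS gg' g'h.
by rewrite (Ir i) ?ltn_eqF // ltnW.
Qed.

Definition clear (r : nat) : com := While r (Dec r).

Lemma exec_clear r f : exec (clear r) f (upd f r 0).
Proof.
move fr : (f r) => a; elim: a f fr => [|a IH] f fr.
  have -> : upd f r 0 = f by apply/funext => r'; rewrite /upd; case: eqP => // ->.
  exact: exec_while0.
apply: exec_whileS (exec_dec r f) _; first by rewrite fr.
have -> : upd f r 0 = upd (upd f r (f r).-1) r 0.
  by apply/funext => r'; rewrite /upd; case: eqP.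
by apply: IH; rewrite /upd eqxx fr.
Qed.

(** [src] is emptied into [dst] and [tmp] simultaneously and then restored from [tmp]. *)
Definition copy (src dst tmp : nat) : com :=
  Seq (clear dst) (Seq (clear tmp) (Seq
    (While src (Seq (Dec src) (Seq (Inc dst) (Inc tmp))))
    (While tmp (Seq (Dec tmp) (Inc src))))).

Lemma exec_copy src dst tmp f : src != dst -> src != tmp -> dst != tmp ->
  exec (copy src dst tmp) f (upd (upd f dst (f src)) tmp 0).
Proof.
move=> sd st dt.
have updE g r a r' : upd g r a r' = if r' == r then a else g r' by [].
have [ds ts td] : [/\ dst != src, tmp != src & tmp != dst].
  by rewrite !(eq_sym _ src) (eq_sym tmp dst).
have simpE := (updE, eqxx, negbTE sd, negbTE st, negbTE dt, negbTE ds, negbTE ts, negbTE td).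
have ext (g h : nat -> nat) : g src = h src -> g dst = h dst -> g tmp = h tmp ->
    (forall r, r != src -> r != dst -> r != tmp -> g r = h r) -> g = h.
  move=> gs gd gt gr; apply/funext => r.
  have [->//|rs] := eqVneq r src; have [->//|rd] := eqVneq r dst.
  by have [->//|rt] := eqVneq r tmp; apply: gr.
pose I i := upd (upd (upd f src (f src - i)) dst i) tmp i.
pose J i := upd (upd (upd f src i) dst (f src)) tmp (f src - i).
have I0 : I 0 = upd (upd f dst 0) tmp 0.
  by apply: ext => [|||r /negbTE rs /negbTE rd /negbTE rt];
    rewrite /I !simpE ?subn0 ?rs ?rd ?rt.
have IJ : I (f src) = J 0.
  by apply: ext => [|||r /negbTE rs /negbTE rd /negbTE rt];
    rewrite /I /J !simpE ?subn0 ?subnn ?rs ?rd ?rt.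
have Jend : J (f src) = upd (upd f dst (f src)) tmp 0.
  by apply: ext => [|||r /negbTE rs /negbTE rd /negbTE rt];
    rewrite /J !simpE ?subnn ?rs ?rd ?rt.
apply: exec_seq (exec_clear _ _) _; apply: exec_seq (exec_clear _ _) _.
have [||g IE gE] := @triple_while src (Seq (Dec src) (Seq (Inc dst) (Inc tmp)))
  (f src) (fun i g => g = I i) _ _ _ erefl.
- by move=> i _ i_n ->; rewrite /I !simpE subn_eq0 eqn_leq i_n.
- move=> i i_n _ ->; eexists.
    by apply: exec_seq (exec_dec _ _) (exec_seq (exec_inc _ _) (exec_inc _ _)).
  apply: ext => [|||r /negbTE rs /negbTE rd /negbTE rt];
    by rewrite /I !simpE ?subnS ?rs ?rd ?rt.
have [||h JE hE] := @triple_while tmp (Seq (Dec tmp) (Inc src))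
  (f src) (fun i g => g = J i) _ _ _ erefl.
- by move=> i _ i_n ->; rewrite /J !simpE subn_eq0 eqn_leq i_n.
- move=> i i_n _ ->; eexists; first by apply: exec_seq (exec_dec _ _) (exec_inc _ _).
  apply: ext => [|||r /negbTE rs /negbTE rd /negbTE rt];
    by rewrite /J !simpE ?subnS ?rs ?rd ?rt.
by rewrite -Jend -hE; apply: exec_seq JE; rewrite -IJ -gE -I0.
Qed.

(** * Compilation of recursive functions *)

(* [compile f ins out b] computes [f] on the registers [ins] into [out], using the
   registers from [b] on as scratch space. *)
Fixpoint compile n (f : recf n) (ins : seq nat) (out b : nat) : com :=
  match f with
  | RZero _ => clear out
  | RSucc => Seq (copy (nth 0 ins 0) out b) (Inc out)
  | RProj _ i => copy (nth 0 ins i) out b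
  | RComp k _ f g =>
      foldr (fun i c => Seq (compile (g i) ins (b + i) (b + k)) c)
        (compile f (iota b k) out (b + k)) (enum 'I_k)
  | RPrec _ f g =>
      Seq (compile f (behead ins) b.+2 b.+4)
      (Seq (copy (nth 0 ins 0) b b.+4)
      (Seq (clear b.+1)
      (Seq (While b
             (Seq (Dec b)
             (Seq (compile g [:: b.+1, b.+2 & behead ins] b.+3 b.+4)
             (Seq (copy b.+3 b.+2 b.+4) (Inc b.+1)))))
      (copy b.+2 out b.+4))))
  | RMu _ f =>
      let c := compile f (b :: ins) b.+1 b.+2 in
      Seq (clear b) (Seq c (Seq (While b.+1 (Seq (Inc b) c)) (copy b out b.+2)))
  end.

Definition agree (b : nat) (f g : nat -> nat) : Prop := forall r, r < b -> g r = f r.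

Definition agree_but (b out : nat) (f g : nat -> nat) : Prop :=
  forall r, r < b -> r != out -> g r = f r.

Lemma map_agree b f g s : agree b f g -> all (fun r => r < b) s -> map g s = map f s.
Proof. by move=> fg /allP hs; apply/eq_in_map => r /hs /fg. Qed.

(** Preservation of the registers below [b] other than [out] allows compiled fragments to be
    chained. Nothing is claimed where [f] is undefined. *)
Definition computes n (f : recf n) : Prop :=
  forall ins out b (v : n.-tuple nat) y s, map s ins = v ->
    all (fun r => r < b) ins -> out < b -> out \notin ins -> reval f v y ->
    exists2 s', exec (compile f ins out b) s s' & s' out = y /\ agree_but b out s s'.

Lemma computes_copy src out b s : src < b -> out < b -> src != out ->
  exists2 s', exec (copy src out b) s s' & s' out = s src /\ agree_but b out s s'.
Proof.
move=> sb ob so; exists (upd (upd s out (s src)) b 0).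
  by apply: exec_copy; rewrite ?(ltn_eqF sb) ?(ltn_eqF ob).
rewrite /upd eqxx (ltn_eqF ob); split=> // r rb ro.
by rewrite (ltn_eqF rb) (negbTE ro).
Qed.

Lemma computes_zero n : computes (RZero n).
Proof.
move=> ins out b v y s _ _ ob _ /= ->; exists (upd s out 0); first exact: exec_clear.
by rewrite /upd eqxx; split=> // r rb /negbTE->.
Qed.

Lemma computes_succ : computes RSucc.
Proof.
move=> [|r ins] out b v y s hv.
  by have := size_tuple v; rewrite -hv.
move=> /andP[rb _] ob; rewrite inE negb_or eq_sym => /andP[ro _] /= ->.
have [s' ss' [s'o hs']] := @computes_copy r out b s rb ob ro.
exists (upd s' out (s' out).+1); first by apply: exec_seq ss' (exec_inc _ _).
rewrite /upd eqxx s'o; split; last by move=> r' r'b r'o; rewrite (negbTE r'o) hs'.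
by rewrite /thead (tnth_nth 0) -hv.
Qed.

Lemma computes_proj n (i : 'I_n) : computes (RProj i).
Proof.
move=> ins out b v y s hv /allP hb ob oi /= ->.
have si : i < size ins by rewrite -(size_map s) hv size_tuple.
have mi : nth 0 ins i \in ins by apply: mem_nth.
have [||s' ss' [s'o hs']] := @computes_copy (nth 0 ins i) out b s _ ob; first exact: hb.
  by apply: contraNneq oi => <-.
by exists s' => //; split=> //; rewrite s'o (tnth_nth 0) -hv (nth_map 0).
Qed.

Lemma computes_comp k n (f : recf k) (g : 'I_k -> recf n) :
  computes f -> (forall i, computes (g i)) -> computes (RComp f g).
Proof.
move=> hf hg ins out b v y s hv hb ob oi /= [w hw hy].
(* [l] lists the arguments still to be computed; the others already sit in the registers [b + i]. *)
pose I (l : seq 'I_k) s' := agree b s s' /\ forall i, i \notin l -> s' (b + i) = tnth w i.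
suff main l s1 : I l s1 -> exists2 s2,
    exec (foldr (fun i c => Seq (compile (g i) ins (b + i) (b + k)) c)
        (compile f (iota b k) out (b + k)) l) s1 s2 & s2 out = y /\ agree_but b out s s2.
  by apply: main; split=> // i; rewrite mem_enum.
elim: l s1 => [|i l IH] s1 [ss1 hs1] /=.
  have [||||s2 s12 [s2o hs2]] := hf (iota b k) out (b + k) w y s1 _ _ _ _ hy.
  - apply: (@eq_from_nth _ 0); rewrite size_map size_iota ?size_tuple // => i ik.
    rewrite (nth_map 0) ?size_iota // nth_iota //.
    by rewrite (hs1 (Ordinal ik)) // (tnth_nth 0).
  - by apply/allP => r; rewrite mem_iota => /andP[].
  - exact: ltn_addr.
  - by rewrite mem_iota leqNgt ob.
  exists s2 => //; split=> // r rb ro.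
  by rewrite hs2 // ?ss1 // ltn_addr.
have [||||s2 s12 [s2o hs2]] := hg i ins (b + i) (b + k) v (tnth w i) s1 _ _ _ _ (hw i).
- by rewrite (map_agree ss1).
- by apply: sub_all hb => r rb; apply: ltn_addr.
- by rewrite ltn_add2l.
- by apply/negP => /(allP hb); rewrite ltnNge leq_addr.
have [|s3 s23 hs3] := IH s2.
  split=> [r rb|j jl].
    by rewrite hs2 ?ss1 // ?ltn_addr // ltn_eqF // ltn_addr.
  have [->//|ji] := eqVneq j i.
  rewrite hs2 ?ltn_add2l ?eqn_add2l // hs1 // inE negb_or ji.
  exact: jl.
by exists s3 => //; apply: exec_seq s12 s23.
Qed.

Lemma prec_chain n (F : n.-tuple nat -> nat -> Prop) G N u y :
  prec_graph F G N u y -> exists Z, [/\ F u (Z 0),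
    forall i, i < N -> G [tuple of i :: Z i :: u] (Z i.+1) & Z N = y].
Proof.
elim: N y => [|N IH] y /=; first by exists (fun=> y).
case=> z /IH[Z [Z0 ZS ZN]] zy.
exists (fun i => if i <= N then Z i else y); rewrite ltnn; split=> // i.
rewrite ltnS => iN; rewrite iN; case: (ltnP i N) => [iN'|Ni]; first exact: ZS.
by have -> : i = N; [apply/eqP; rewrite eqn_leq iN|rewrite ZN].
Qed.

Lemma computes_prec n (f : recf n) (g : recf n.+2) :
  computes f -> computes g -> computes (RPrec f g).
Proof.
move=> hf hg [|r0 ins] out b v y s hv; first by have := size_tuple v; rewrite -hv.
move=> /andP[r0b hb] ob; rewrite inE negb_or eq_sym => /andP[r0o oi] /=.
have v0 : thead v = s r0 by rewrite /thead (tnth_nth 0) -hv.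
have vt : map s ins = [tuple of behead v] by rewrite /= -hv.
rewrite v0; move: [tuple of behead v] vt => u hu {v hv v0}.
have B1 : b <= b.+1 := leqnSn b.
have B2 : b <= b.+2 := leqW B1.
have B3 : b <= b.+3 := leqW B2.
have B4 : b <= b.+4 := leqW B3.
have hbS c : b <= c -> all (fun r => r < c) ins.
  by move=> bc; apply: sub_all hb => r rb; apply: leq_trans bc.
have nins c : b <= c -> c \notin ins.
  by move=> bc; apply/negP => /(allP hb); rewrite ltnNge bc.
have ltS k : k < 4 -> k + b < 4 + b by rewrite ltn_add2r.
have [b0 b1 b2 b3] : [/\ b < b.+4, b.+1 < b.+4, b.+2 < b.+4 & b.+3 < b.+4].
  by split; [apply: (ltS 0)|apply: (ltS 1)|apply: (ltS 2)|apply: (ltS 3)].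
have neS k l : k != l -> k + b != l + b by rewrite eqn_add2r.
move=> /prec_chain[Z [Z0 ZS ZN]]; set N := s r0 in ZS ZN.
(* After [i] rounds, [b] counts the remaining rounds, [b.+1] the completed ones, and [b.+2] holds
   the current value; [b.+3] is used for the next value. *)
pose I i s' := [/\ agree b s s', s' b = N - i, s' b.+1 = i & s' b.+2 = Z i].
have [s1 e1 [s1z hs1]] :=
  hf ins b.+2 b.+4 u _ s hu (hbS _ B4) b2 (nins _ B2) Z0.
have [s2 e2 [s2b hs2]] :=
  @computes_copy r0 b b.+4 s1 (leq_trans r0b B4) b0 (negbT (ltn_eqF r0b)).
have e3 := exec_clear b.+1 s2.
have I0 : I 0 (upd s2 b.+1 0).
  rewrite /I /upd eqxx subn0 (negbTE (neS 0 1 _)) // (negbTE (neS 2 1 _)) //.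
  split=> // [r rb||].
  - rewrite ltn_eqF ?ltnS 1?ltnW // hs2 ?ltn_eqF ?(leq_trans rb) //.
    by rewrite hs1 ?(leq_trans rb) // ltn_eqF // (leq_trans rb).
  - by rewrite s2b hs1 ?(leq_trans r0b) // ltn_eqF // (leq_trans r0b).
  - by rewrite hs2 ?(neS 2 0).
have [||s4 e4 [hs4 _ _ s4z]] :=
  triple_while (r := b) (n := N) (I := I) (c := Seq (Dec b)
    (Seq (compile g [:: b.+1, b.+2 & ins] b.+3 b.+4)
    (Seq (copy b.+3 b.+2 b.+4) (Inc b.+1)))) _ _ I0.
- by move=> i a iN [_ -> _ _]; rewrite subn_eq0 eqn_leq iN.
- move=> i iN a [ha ab ab1 ab2].
  pose a1 := upd a b (a b).-1.
  have a1E r : r != b -> a1 r = a r by rewrite /a1 /upd => /negbTE->.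
  have [|||a2 d2 [a2z ha2]] := hg [:: b.+1, b.+2 & ins] b.+3 b.+4
    [tuple of i :: Z i :: u] (Z i.+1) a1 _ _ b3 _ (ZS _ iN).
  + rewrite /= !a1E ?(neS 1 0) ?(neS 2 0) // ab1 ab2 -hu; congr [:: _, _ & _].
    by apply: map_agree hb => r rb; rewrite a1E ?ltn_eqF // ha.
  + by rewrite /= b1 b2 hbS.
  + by rewrite !inE (negbTE (neS 3 1 _)) // (negbTE (neS 3 2 _)) //= nins.
  have [a3 d3 [a3z ha3]] := @computes_copy b.+3 b.+2 b.+4 a2 b3 b2 (neS 3 2 isT).
  exists (upd a3 b.+1 (a3 b.+1).+1).
    apply: exec_seq (exec_dec _ _) (exec_seq d2 (exec_seq d3 (exec_inc _ _))).
  rewrite /I /upd eqxx (negbTE (neS 0 1 _)) // (negbTE (neS 2 1 _)) // a3z a2z.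
  have a3E r : r < b.+4 -> r != b.+2 -> r != b.+3 -> r != b -> a3 r = a r.
    by move=> r4 r2 r3 r0'; rewrite ha3 // ha2 // a1E.
  split=> // [r rb||].
  + rewrite ltn_eqF ?ltnS 1?ltnW // a3E ?ha //; last by rewrite ltn_eqF.
    * exact: leq_trans B4.
    * by rewrite ltn_eqF // (leq_trans rb).
    * by rewrite ltn_eqF // (leq_trans rb).
  + rewrite ha3 ?(neS 0 2) // ha2 ?(neS 0 3) // /a1 /upd eqxx ab.
    by rewrite subnS.
  + by rewrite a3E ?(neS 1 2) ?(neS 1 3) ?(neS 1 0) // ab1.
have [|s5 e5 [s5o hs5]] := @computes_copy b.+2 out b.+4 s4 b2 (leq_trans ob B4).
  by rewrite gtn_eqF // (leq_trans ob).
exists s5.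
  by apply: exec_seq e1 (exec_seq e2 (exec_seq e3 (exec_seq e4 e5))).
rewrite s5o s4z ZN; split=> // r rb ro.
by rewrite hs5 ?hs4 // (leq_trans rb).
Qed.

Lemma computes_mu n (f : recf n.+1) : computes f -> computes (RMu f).
Proof.
move=> hf ins out b v y s hv hb ob oi /= [hy hlt].
have b1 : b < b.+2 by rewrite ltnS.
have bn : b \notin ins by apply/negP => /(allP hb); rewrite ltnn.
have bn1 : b.+1 \notin b :: ins.
  rewrite inE negb_or gtn_eqF //=; apply/negP => /(allP hb).
  by rewrite ltnNge leqnSn.
(* [b] holds the candidate and [b.+1] the value of [f] at it, which vanishes for the first time at
   [y]. *)
pose I i s' := [/\ agree b s s', s' b = i & (s' b.+1 == 0) = (i == y)].
have body i s' : i <= y -> agree b s s' -> s' b = i ->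
    exists2 s'', exec (compile f (b :: ins) b.+1 b.+2) s' s'' & I i s''.
  move=> iy hs' s'b.
  have [u [hu uy]] : exists u, reval f [tuple of i :: v] u /\ (u == 0) = (i == y).
    have [->|iy'] := eqVneq i y; first by exists 0.
    have [|u hu] := hlt i; first by rewrite ltn_neqAle iy'.
    by exists u.+1.
  have [||s'' e [s''u hs'']] := hf (b :: ins) b.+1 b.+2 [tuple of i :: v] u s' _ _ (ltnSn _) bn1 hu.
  - by rewrite /= s'b (map_agree hs' hb) hv.
  - by rewrite /= b1; apply: sub_all hb => r rb; apply: leq_trans (ltnW b1).
  exists s'' => //; rewrite /I s''u (hs'' b b1) ?(ltn_eqF (ltnSn b)) //; split=> // r rb.
  by rewrite hs'' ?hs' // ?ltn_eqF // (leq_trans rb) // ltnW.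
have [||s1 e1 I0] := body 0 (upd s b 0) (leq0n y).
- by move=> r rb; rewrite /upd ltn_eqF.
- by rewrite /upd eqxx.
have [||s2 e2 [hs2 s2b _]] := triple_while (r := b.+1) (n := y) (I := I)
  (c := Seq (Inc b) (compile f (b :: ins) b.+1 b.+2)) _ _ I0.
- by move=> i a _ [_ _ ->].
- move=> i iy a [ha ab _].
  have [||a' e hI] := body i.+1 (upd a b (a b).+1) iy.
  + by move=> r rb; rewrite /upd ltn_eqF // ha.
  + by rewrite /upd eqxx ab.
  by exists a' => //; apply: exec_seq (exec_inc _ _) e.
have [|s3 e3 [s3o hs3]] := @computes_copy b out b.+2 s2 b1 (ltn_trans ob b1).
  by rewrite gtn_eqF.
exists s3.
  by apply: exec_seq (exec_clear _ _) (exec_seq e1 (exec_seq e2 e3)).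
rewrite s3o s2b; split=> // r rb ro.
by rewrite hs3 ?hs2 // (ltn_trans rb).
Qed.

Lemma compile_correct n (f : recf n) : computes f.
Proof.
elim: f => [n'||n' i|k n' f hf g hg|n' f hf g hg|n' f hf].
- exact: computes_zero.
- exact: computes_succ.
- exact: computes_proj.
- exact: computes_comp.
- exact: computes_prec.
- exact: computes_mu.
Qed.

(** * Diagonalization *)

Definition computable n (F : n.-tuple nat -> nat) : Prop :=
  exists f : recf n, forall v, reval f v (F v).

Lemma computable_ext n (F G : n.-tuple nat -> nat) :
  F =1 G -> computable F -> computable G.
Proof. by move=> FG [f hf]; exists f => v; rewrite -FG. Qed.

Lemma computable_proj n (i : 'I_n) : computable (fun v => tnth v i).
Proof. by exists (RProj i). Qed.

Lemma computable_comp k n (F : k.-tuple nat -> nat) (G : 'I_k -> n.-tuple nat -> nat) :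
  computable F -> (forall i, computable (G i)) ->
  computable (fun v => F [tuple G i v | i < k]).
Proof.
move=> [f hf] /choice[g hg]; exists (RComp f g) => v /=.
exists [tuple G i v | i < k]; last exact: hf.
by move=> i; rewrite tnth_mktuple.
Qed.

Lemma computable_succ n (F : n.-tuple nat -> nat) :
  computable F -> computable (fun v => (F v).+1).
Proof.
move=> hF; have hS : computable (fun v : 1.-tuple nat => (thead v).+1) by exists RSucc.
apply: computable_ext (computable_comp hS (fun=> hF)) => v.
by rewrite /thead tnth_mktuple.
Qed.

Lemma computable_const n c : computable (fun _ : n.-tuple nat => c).
Proof. by elim: c => [|c /computable_succ//]; exists (RZero n). Qed.

Lemma computable_rec n (G : 2.-tuple nat -> nat) (h : nat -> nat) (F : n.-tuple nat -> nat) :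
  computable G -> (forall m, h m.+1 = G [tuple m; h m]) -> computable F ->
  computable (fun v => h (F v)).
Proof.
move=> [g hg] hS hF; have [c hc] := computable_const 0 (h 0).
have hh : computable (fun v : 1.-tuple nat => h (thead v)).
  exists (RPrec c g) => v /=; elim: (thead v) => [|m IH] /=; first exact: hc.
  exists (h m) => //; rewrite hS.
  have -> : [tuple m; h m] = [tuple of m :: h m :: behead v].
    by apply: val_inj => /=; case: v IH => -[|a [|b l]].
  exact: hg.
apply: computable_ext (computable_comp hh (fun=> hF)) => v.
by rewrite /thead tnth_mktuple.
Qed.

Lemma computable_add n (F G : n.-tuple nat -> nat) :
  computable F -> computable G -> computable (fun v => F v + G v).
Proof.
move=> hF hG.
have hadd : computable (fun v : 2.-tuple nat => tnth v ord0 + tnth v (lift ord0 ord0)).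
  have [f hf] := computable_proj (ord0 : 'I_1).
  have [g hg] := computable_succ (computable_proj (lift ord0 ord0 : 'I_3)).
  exists (RPrec f g) => v /=; rewrite /thead.
  set b := tnth v (lift _ _); elim: (tnth v ord0) => [|m IH] /=.
    have -> : b = tnth [tuple of behead v] ord0; last exact: hf.
    by rewrite /b !(tnth_nth 0) /= nth_behead.
  by exists (m + b).
pose H (i : 'I_2) := if i == ord0 then F else G.
have hH i : computable (H i) by rewrite /H; case: ifP.
apply: computable_ext (computable_comp hadd hH) => v.
by rewrite !tnth_mktuple.
Qed.

Lemma computable_triangle n (F : n.-tuple nat -> nat) :
  computable F -> computable (fun v => 'C((F v).+1, 2)).
Proof.
apply: (@computable_rec _ (fun v => tnth v ord0 + tnth v (lift ord0 ord0) + 1)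
  (fun m => 'C(m.+1, 2))).
  by apply: computable_add (computable_const _ 1); apply: computable_add;
    apply: computable_proj.
by move=> m; rewrite binS bin1 [RHS]addnAC addn1 [RHS]addnC.
Qed.

Lemma computable_pair n (F G : n.-tuple nat -> nat) :
  computable F -> computable G -> computable (fun v => cantor_pair (F v) (G v)).
Proof.
by move=> hF hG; apply: computable_add => //; apply/computable_triangle/computable_add.
Qed.

Lemma computable_node n k (F G : n.-tuple nat -> nat) : computable F -> computable G ->
  computable (fun v => 4 * cantor_pair (F v) (G v) + k).
Proof.
move=> hF hG; apply: computable_add (computable_const _ k).
have hP := computable_pair hF hG; have hP2 := computable_add hP hP.
by apply: computable_ext (computable_add hP2 hP2) => v; rewrite !addnn -!mul2n mulnA.
Qed.

(** One step of the recursion adds two layers of [loading], an incrementing one and an idle one; [G]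
    spells out their codes. *)
Lemma computable_loading n (F : n.-tuple nat -> nat) (B : form) : computable F ->
  computable (fun v => code (loading (F v).*2 B)).
Proof.
pose G (v : 2.-tuple nat) :=
  let: x := tnth v (lift ord0 ord0) in
  4 * cantor_pair (code (LInc 0)) (4 * cantor_pair (code (LW true))
    (4 * cantor_pair (4 * cantor_pair (code LNop) (4 * cantor_pair (code (LW false))
      (4 * cantor_pair x (code (LJT false)) + 2) + 3) + 1) (code (LJT true)) + 2) + 3) + 1.
apply: (@computable_rec _ G (fun m => code (loading m.*2 B))).
  by do !apply: computable_node; try exact: computable_const; apply: computable_proj.
by move=> m; rewrite doubleS /= odd_double.
Qed.

Definition reduct_code (x m : nat) : nat :=
  4 * cantor_pair x (4 * cantor_pair
    (4 * cantor_pair (code (LX false ⩓ LT false ⩓ LCol0 ⩓ LRow0)%form)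
       (code (loading m (LQ 0))) + 1) (code (goal false)) + 3) + 3.

Lemma code_reduct R Q m :
  code (reduct R Q m) = reduct_code (code (prem (rules R Q))) m.
Proof.
have codeI A B : code (A ⟶ B)%form = 4 * cantor_pair (code A) (code B) + 3 by [].
have codeA A B : code (A ⩓ B)%form = 4 * cantor_pair (code A) (code B) + 1 by [].
by rewrite /reduct_code -codeA -codeI -codeI.
Qed.

(** The diagonal substitution: [x] is both the code of the premise and the number to be loaded,
    which takes [x.*2] loading steps. *)
Lemma computable_reduct : exists f : recf 1, forall x,
  reval f [tuple x] (reduct_code x x.*2).
Proof.
have [f hf] : computable (fun v : 1.-tuple nat =>
    reduct_code (tnth v ord0) (tnth v ord0).*2).
  do !apply: computable_node; try exact: computable_const; try exact: computable_proj.
  exact/computable_loading/computable_proj.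
exists f => x; exact: hf.
Qed.

Lemma iter_step_halted t c : c.1 = (0, [::]) -> (iter t step c).1 = (0, [::]).
Proof. by elim: t => //= t IH /IH; rewrite /step /loader_next => ->. Qed.

Lemma iter_sstep_loop t r q f : r != q -> f r != 0 ->
  (iter t sstep ([:: While r (Inc q)], f)).1 != [::].
Proof.
move=> rq fr; have [g gr] : exists2 g, g r != 0 &
    iter t sstep ([:: While r (Inc q)], f) = ([:: While r (Inc q)], g) \/
    iter t sstep ([:: While r (Inc q)], f) = ([:: Inc q; While r (Inc q)], g).
  elim: t => [|t [g gr]] /=; first by exists f; [|left].
  case=> ->; first by exists g => //; right; rewrite /sstep /= (negbTE gr).
  by exists (upd g q (g q).+1); [rewrite /upd (negbTE rq)|left].
by case=> ->; apply/eqP.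
Qed.

Lemma undecidable_between (L : set form) :
  (forall A, TWJplus A -> L A) -> (forall A, L A -> SetFr A) -> undecidable_logic L.
Proof.
move=> TL LS [d hd]; have [g hg] := computable_reduct.
pose dg := RComp d (fun _ : 'I_1 => g).
(* On input [n], [p] asks for the verdict of [d] on the formula with premise code [n] and numeral
   [n]; it halts if the verdict is 0 and loops otherwise. *)
pose p := Seq (compile dg [:: 0] 1 2) (While 1 (Inc 2)).
have [R [Q' hQ]] := closed_states_exist p.
set Q := _ :: Q' in hQ.
(* The input is the code of the premise that belongs to [p] itself. *)
have [n nE] : exists n, code (prem (rules R Q)) = n by exists (code (prem (rules R Q))).
pose A := reduct R Q n.*2.
have [b db bL] := hd A.
have index0 : index [:: p] Q = 0 by rewrite /= eqxx.
have even_n : ~~ odd n.*2 by rewrite odd_double.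
have dgb : reval dg [tuple n] b.
  exists [tuple code A] => // i.
  by rewrite (ord1 i) [tnth _ _]code_reduct nE; apply: hg.
have [||||s es [s1 _]] := compile_correct (ins := [:: 0]) (out := 1) (b := 2)
  (s := upd (fun=> 0) 0 n) _ _ _ _ dgb; try by [].
have start_run : iter n.*2 step ((n.*2, [:: p]), fun=> 0) =
    ((0, [:: p]), upd (fun=> 0) 0 n) by rewrite iter_step_load.
have run t : iter (t + n.*2) step ((n.*2, [:: p]), fun=> 0) =
    let: c := iter t sstep ([:: p], upd (fun=> 0) 0 n) in ((0, c.1), c.2).
  by rewrite iterD start_run iter_step.
(* If the verdict is negative, [p] halts and [A] is a theorem of TWJ+; if it is positive, [p] runs
   forever and [A] is refuted in a set frame. *)
move: bL db s1; case: b {dgb} => bL _ s1; last first.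
  suff /TL/bL : TWJplus A by [].
  apply: (halting_reduct hQ even_n (mem_head _ _) index0).
  have [t ht] := exec_seq es (@exec_while0 1 (Inc 2) s s1) [::].
  by exists (t + n.*2); rewrite run ht.
have /SetFr_sat : SetFr A by apply/LS/bL.
move/(_ (grid_val Q n.*2 [:: p])); apply: reduct_refuted => // t.
move=> halt; have [t1 ht1] := es [:: While 1 (Inc 2)].
have ht1S : iter t1.+1 sstep ([:: p], upd (fun=> 0) 0 n) = ([:: While 1 (Inc 2)], s).
  by rewrite iterSr.
(* A run halted at time [t] would still be halted [t] steps after the entry into the final loop,
   which never ends. *)
have := iter_step_halted (t1.+1 + n.*2) halt; rewrite -iterD addnAC (addnC t1.+1) run iterD ht1S.
have := @iter_sstep_loop t 1 2 s isT; rewrite s1 => /(_ isT) /eqP h.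
by move/(congr1 snd)/h.
Qed.

Theorem theorem6p4 :
  undecidable_logic TWJplus /\
  undecidable_logic Cplus /\
  undecidable_logic Tplus /\
  undecidable_logic Eplus /\
  undecidable_logic Rplus /\
  undecidable_logic SetFr.
Proof.
have TC A : TWJplus A -> Cplus A := @thm_mono _ _ A C_TWJ.
have CT A : Cplus A -> Tplus A := @thm_mono _ _ A T_C.
have TE A : Tplus A -> Eplus A := @thm_mono _ _ A E_T.
have ER A : Eplus A -> Rplus A := @thm_mono _ _ A R_E.
have RS := Rplus_SetFr.
split; [|split; [|split; [|split; [|split]]]];
  by apply: undecidable_between => A; auto 8.
Qed.
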